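(* Let $(\theta_n)_{n\ge0}$ be generated by MLMC-AMSGrad as described in the context, with $\rho_1,\rho_2\in[0,1)$, $\delta>0$, a positive non-increasing sequence $(\gamma_n)_{n\ge1}$ and positive non-decreasing sequences $(T_n)_{n\ge1}$, $(\varepsilon_n)_{n\ge1}$. Assume: (i) $V:\mathbb{R}^d\to\mathbb{R}$ is differentiable and $\|\nabla V(\theta)-\nabla V(\theta')\|\le L\|\theta-\theta'\|$ for all $\theta,\theta'\in\mathbb{R}^d$; (ii) there is $G>0$ such that $\|H_\theta\|_\infty\le G$ for all $\theta\in\mathbb{R}^d$; (iii) there are constants $c_1,c_2$ such that for all $n\ge 0$, $$\left\|\mathbb{E}[\widehat H^{(n+1)}\mid\mathcal F_n]-h(\theta_n)\right\|\le \frac{c_1G}{T_{n+1}},\qquad \mathbb{E}\left[\|\widehat H^{(n+1)}\|^2\right]\le c_2G^2\log(T_{n+1}).$$ Define $\underline\varepsilon_0=0$ and $\underline\varepsilon_n=\left(\delta+\varepsilon_n(1-\rho_2^n)\right)^{-1/2}$ for $n\ge1$. For $N\ge1$ put $\varpi_N=\sum_{k=0}^N\gamma_{k+1}\underline\varepsilon_k$ and let $R$ be a random variable, independent of the algorithm, with $\mathbb{P}[R=n]=\gamma_{n+1}\underline\varepsilon_n/\varpi_N$ for $n\in\{0,\dots,N\}$. Then for every $N\ge1$, $$\mathbb{E}\left[\|\nabla V(\theta_R)\|^2\right]\le\frac1{\varpi_N}\Bigg\{\mathbb{E}[V(\theta_0)]-V(\theta^* )+b_0+b_1\sum_{n=1}^N\frac{\gamma_{n+1}}{T_{n+1}}+b_2\sum_{n=1}^N\gamma_{n+1}^2\log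 T_{n+1}+b_3\sum_{n=1}^N(1-\rho_1^n)\gamma_n^2\log T_n+b_4\sum_{n=1}^N\left(1-\frac{\gamma_{n+1}^2}{\gamma_n^2}\right)\Bigg\},$$ where $$b_0=\frac{dG}{2\delta(1-\rho_1)}+\gamma_1\sqrt{\frac d\delta}\left(1+2\frac{\log T_1}{\log2}\right)G^2+c_2\frac L\delta G^2\gamma_1^2\log T_1+\underline\varepsilon_0\gamma_1G^2,\qquad b_1=c_1\frac{G^2}{\sqrt\delta},$$ $$b_2=\frac{c_2}{2\delta}(1+2L+2\delta G)G^2,\qquad b_3=\frac{c_2G^2}{2\delta(1-\rho_1)}\left(\rho_1^2L^2+2\rho_1^2L+\rho_1\delta(1-\rho_1)G\right),\qquad b_4=\frac{d\rho_1G}{2\delta(1-\rho_1)}.$$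
   Context: Setting. $\|\cdot\|$ is the Euclidean norm on $\mathbb{R}^d$. $\theta^*\in\mathbb{R}^d$ is a global minimizer of $V$. For each $\theta\in\mathbb{R}^d$, $H_\theta:\mathbb{X}\to\mathbb{R}^d$ is a measurable function on a measurable space $\mathbb{X}\subseteq\mathbb{R}^q$, $\|H_\theta\|_\infty=\sup_{x\in\mathbb{X}}\|H_\theta(x)\|$, $P_\theta$ is a Markov kernel on $\mathbb{X}$ with invariant probability $\pi_\theta$, and $h(\theta)=\mathbb{E}_{\pi_\theta}[H_\theta(X)]$. Throughout it is assumed that $h(\theta)=\nabla V(\theta)$ for all $\theta$. MLMC estimator. $(K_n)_{n\ge1}$ are i.i.d. geometric, $\mathbb{P}(K_n=k)=2^{-k}$ for $k\ge1$. $\mathcal F_0$ is trivial and $\mathcal F_n=\sigma(K_1,\mathbf X^{(1)},\dots,K_n,\mathbf X^{(n)})$. At step $n\ge0$, given $\mathcal F_n$, $\mathbf X^{(n+1)}=(X_i^{(n+1)})_{i\ge1}$ is a Markov chain with kernel $P_{\theta_n}$, and $K_{n+1}$ is independent of $\mathcal F_n$ and $\mathbf X^{(n+1)}$. For an integer $p\ge1$ let $H_\theta^{(p)}(\mathbf x)=\frac1p\sum_{i=1}^pH_\theta(x_i)$. With $t_{n+1}=2^{K_{n+1}}$, the MLMC estimator is $$\widehat H^{(n+1)}=H_{\theta_n}(X_1^{(n+1)})+t_{n+1}\left\{H_{\theta_n}^{(t_{n+1})}(\mathbf X^{(n+1)})-H_{\theta_n}^{(t_{n+1}/2)}(\mathbf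 X^{(n+1)})\right\}\mathbf 1_{t_{n+1}\le T_{n+1}}.$$ MLMC-AMSGrad. Start from $\theta_0\in\mathbb{R}^d$, $m_{-1}=0$, $W_{-1}=\widehat W_{-1}=0$. For $n\ge0$ set $$m_n=\rho_1m_{n-1}+(1-\rho_1)\widehat H^{(n+1)},\qquad W_n=\rho_2W_{n-1}+(1-\rho_2)\min\left\{\varepsilon_{n+1}I_d,\ \mathrm{Diag}\left(\widehat H^{(n+1)}(\widehat H^{(n+1)})^\top\right)\right\},$$ $$\widehat W_n=\max\{\widehat W_{n-1},W_n\},\qquad A_n=(\delta I_d+\widehat W_n)^{-1/2},\qquad \theta_{n+1}=\theta_n-\gamma_{n+1}A_nm_n.$$ Here $\mathrm{Diag}(M)$ is the diagonal matrix formed from the diagonal of $M$, and min and max of diagonal matrices are taken entrywise on the diagonal.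
   Formalization: The constant c_2 is taken positive (with c_2=0, H=V=0 and T_n=1/4 the right side can be negative); also d≥1 is assumed and the estimator Ĥ^(n) is assumed F_n-measurable, as (iii) implicitly requires. *)

(* Defs.v *)
From HB Require Import structures.
From mathcomp Require Import all_boot all_order all_algebra.
From mathcomp Require Import all_classical all_reals all_analysis.
Import Order.TTheory GRing.Theory Num.Theory.
Import numFieldNormedType.Exports.

Set Implicit Arguments.
Unset Strict Implicit.
Unset Printing Implicit Defensive.

Local Open Scope classical_set_scope.
Local Open Scope ring_scope.

Section euclidean.
Context {R : realType} {d : nat}.

(* The library norm `|v| on matrices is the sup norm. *)
Definition enorm (v : 'cV[R]_d) : R := Num.sqrt (\sum_(i < d) v i 0 ^+ 2).

Definition grad (V : 'cV[R]_d -> R) (theta : 'cV[R]_d) : 'cV[R]_d :=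
  \col_(i < d) 'D_(delta_mx i 0) V theta.

(* Extended-real valued: a real-valued sup of an unbounded set would be 0. *)
Definition sup_norm {X : Type} (f : X -> 'cV[R]_d) : \bar R :=
  ereal_sup (range (fun x => (enorm (f x))%:E)).

End euclidean.

Section diagonal_matrices.
Context {R : realType} {d : nat}.
Implicit Types M N : 'M[R]_d.

Definition Diag M : 'M[R]_d := diag_mx (\row_i M i i).
Definition diag_min M N : 'M[R]_d := diag_mx (\row_i Num.min (M i i) (N i i)).
Definition diag_max M N : 'M[R]_d := diag_mx (\row_i Num.max (M i i) (N i i)).

(* M^(-1/2) for a diagonal matrix M with positive diagonal. *)
Definition diag_invsqrt M : 'M[R]_d := diag_mx (\row_i (Num.sqrt (M i i))^-1).

End diagonal_matrices.

Section markov.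
Context {R : realType} {dX : measure_display} {X : measurableType dX}.

Definition invariant_law (k : R.-pker X ~> X) (mu : probability X R) : Prop :=
  forall B, measurable B -> (\int[mu]_(x in [set: X]) k x B = mu B)%E.

Definition mean_field {d : nat} (H : 'cV[R]_d -> X -> 'cV[R]_d)
    (mu : 'cV[R]_d -> probability X R) (theta : 'cV[R]_d) : 'cV[R]_d :=
  \col_(i < d) (\int[mu theta]_(x in [set: X]) H theta x i 0)%R.

End markov.

Section conditional_expectation.
Context {R : realType} {dO : measure_display} {Omega : measurableType dO}.
Variable P : probability Omega R.

Definition measurable_wrt (G : set (set Omega)) (Y : Omega -> R) : Prop :=
  forall B, measurable B -> G (Y @^-1` B).

(* Y is a version of E[Z | G], for G a sub-sigma-algebra. *)
Definition is_cond_exp (G : set (set Omega)) (Z Y : Omega -> R) : Prop :=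
  [/\ P.-integrable [set: Omega] (EFin \o Z),
      P.-integrable [set: Omega] (EFin \o Y),
      measurable_wrt G Y &
      forall A, G A ->
        (\int[P]_(w in A) (Y w)%:E = \int[P]_(w in A) (Z w)%:E)%E].

Definition is_cond_exp_vec {d : nat} (G : set (set Omega))
    (Z Y : Omega -> 'cV[R]_d) : Prop :=
  forall i, is_cond_exp G (fun w => Z w i 0) (fun w => Y w i 0).

Definition independent_classes (G1 G2 : set (set Omega)) : Prop :=
  forall A B, G1 A -> G2 B -> P (A `&` B) = (P A * P B)%E.

(* The families are indexed by the integers j >= 1. *)
Definition mutually_independent (K : nat -> {RV P >-> nat}) : Prop :=
  forall (s : seq nat) (B : nat -> set nat), uniq s -> all (leq 1) s ->
    P (\big[setI/setT]_(j <- s) (K j @^-1` B j)) =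
    (\prod_(j <- s) P (K j @^-1` B j))%E.

End conditional_expectation.

(* K n and Xs n i stand for K_n and X_i^(n), with n, i >= 1; the values at index
   0 are never used. *)
Section sampling.
Context {R : realType} {dO dX : measure_display}.
Context {Omega : measurableType dO} {X : measurableType dX}.
Variable P : probability Omega R.
Variables (K : nat -> {RV P >-> nat}) (Xs : nat -> nat -> {RV P >-> X}).

Definition chain_events (n : nat) (D : set nat) : set (set Omega) :=
  \bigcup_(i in D) g_sigma_algebra_preimage (Xs n i).

Definition history (D : set nat) : set (set Omega) :=
  \bigcup_(j in D)
    (g_sigma_algebra_preimage (K j) `|` chain_events j [set i | (1 <= i)%N]).

Definition filtration (n : nat) : set (set Omega) :=
  <<s history [set j | (1 <= j <= n)%N] >>.

Definition chain_filtration (n i : nat) : set (set Omega) :=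
  <<s history [set j | (1 <= j <= n)%N]
      `|` chain_events n.+1 [set l | (1 <= l <= i)%N] >>.

Definition full_chain_filtration (n : nat) : set (set Omega) :=
  <<s history [set j | (1 <= j <= n)%N]
      `|` chain_events n.+1 [set l | (1 <= l)%N] >>.

Definition algorithm_sigma : set (set Omega) :=
  <<s history [set j | (1 <= j)%N] >>.

(* Given F_n, X^(n+1) is a Markov chain with kernel k_{theta_n}; its initial
   distribution is left free. *)
Definition conditionally_markov {d : nat} (n : nat)
    (k : 'cV[R]_d -> R.-pker X ~> X) (theta : Omega -> 'cV[R]_d) : Prop :=
  forall (i : nat) (B : set X), (1 <= i)%N -> measurable B ->
    is_cond_exp P (chain_filtration n i)
      (\1_(Xs n.+1 i.+1 @^-1` B))
      (fun w => fine (k (theta w) (Xs n.+1 i w) B)).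

End sampling.

Section amsgrad.
Context {R : realType} {d : nat} {X : Type}.
Variable H : 'cV[R]_d -> X -> 'cV[R]_d.

(* H_theta^(p)(x); the path x is indexed from 1. *)
Definition path_average (theta : 'cV[R]_d) (p : nat) (x : nat -> X) :
    'cV[R]_d :=
  p%:R^-1 *: \sum_(1 <= i < p.+1) H theta (x i).

(* The halving of t is exact because k >= 1 almost surely. *)
Definition mlmc (theta : 'cV[R]_d) (T : R) (k : nat) (x : nat -> X) :
    'cV[R]_d :=
  let t := (2 ^ k)%N in
  H theta (x 1%N) +
  (t%:R * (t%:R <= T)%R%:R) *:
    (path_average theta t x - path_average theta (t %/ 2) x).

(* The state at time n is (theta_n, m_{n-1}, W_{n-1}, \hat W_{n-1}). *)
Record amsgrad_state := AmsgradState {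
  iterate : 'cV[R]_d;
  momentum : 'cV[R]_d;
  second_moment : 'M[R]_d;
  max_second_moment : 'M[R]_d }.

Variables (rho1 rho2 delta : R) (gamma T eps : nat -> R).

(* Transition from time n to time n+1; g stands for \hat H^(n+1). *)
Definition amsgrad_step (n : nat) (s : amsgrad_state) (g : 'cV[R]_d) :
    amsgrad_state :=
  let m := rho1 *: momentum s + (1 - rho1) *: g in
  let W := rho2 *: second_moment s
           + (1 - rho2) *: diag_min (eps n.+1)%:M (Diag (g *m g^T)) in
  let What := diag_max (max_second_moment s) W in
  let A := diag_invsqrt (delta%:M + What) in
  AmsgradState (iterate s - gamma n.+1 *: (A *m m)) m W What.

Variables (theta0 : 'cV[R]_d) (k : nat -> nat) (x : nat -> nat -> X).

Fixpoint amsgrad (n : nat) : amsgrad_state :=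
  if n is n'.+1 then
    let s := amsgrad n' in
    amsgrad_step n' s (mlmc (iterate s) (T n) (k n) (x n))
  else AmsgradState theta0 0 0 0.

Definition mlmc_at (n : nat) : 'cV[R]_d :=
  mlmc (iterate (amsgrad n.-1)) (T n) (k n) (x n).

End amsgrad.

Section weights.
Context {R : realType}.
Variables (rho2 delta : R) (gamma eps : nat -> R).

Definition eps_low (n : nat) : R :=
  if n is 0 then 0 else (Num.sqrt (delta + eps n * (1 - rho2 ^+ n)))^-1.

Definition varpi (N : nat) : R :=
  \sum_(0 <= k < N.+1) gamma k.+1 * eps_low k.

End weights.

(* Main.v *)
Require Import Defs.
From HB Require Import structures.
From mathcomp Require Import all_boot all_order all_algebra.
From mathcomp Require Import ring lra.
From mathcomp Require Import all_classical all_reals all_analysis measurable_realfun.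
Import Order.TTheory GRing.Theory Num.Theory.
Import numFieldNormedType.Exports.

Local Open Scope classical_set_scope.
Local Open Scope ring_scope.

(** Solving the momentum recursion m' = rho1 m + (1 - rho1) g for the sample g
    gives g = m' + c (m' - m) with c = rho1 / (1 - rho1). Paired with the
    gradient D at the current iterate through the step matrix gamma A, the first
    part is a decrease of V, by [descent_lemma]. The second part is an increment
    of the pairing <D, gamma A m>, up to two errors: the change of D along the
    last step, which the Lipschitz bound controls by the squared step length,
    and the drift of gamma A. This suggests to follow, instead of V, the
    potential V - c <D, gamma A m> with corrections for the drift
    ([potential], [lyapunov_step], [gain_sum]).

    The drift is the delicate part. Bounding c G |drift| |gamma m| by the
    squares of both factors would cost a factor 1 / (1 - rho1) on the squared
    samples, which the term of b3 in G does not have. The product is split with the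
    drift itself as a weight ([weighted_young]). The terms that are linear in
    the drift telescope, because the entries of A decrease and are at most
    delta^(-1/2); they give the term in d G of b0, and b4 where gamma decreases.
    The other terms are the drift times gamma^2 m^2. They are absorbed by a
    momentum energy in the potential, whose increase per step is at most
    rho1 G / 2 times gamma^2 |g|^2, because m^2 relaxes towards g^2 at rate
    1 - rho1 and this rate cancels the denominator of c.

    The squared samples are only affordable from the second one on. The first
    sample is removed from the momentum ([tail]). Over the whole run it acts as
    one full step, which is paid linearly by the mean of |g_1|. Level k of the
    estimator has probability 2^-k, and norm at most G + 2 G 2^k if 2^k <= T_1
    and at most G otherwise, so this mean is at most G (1 + 2 log_2 T_1)
    ([mean_capped_level]).

    In the mean, the new sample is tested against the gradient and the
    preconditioner of the previous step, which are functions of the past. The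
    sample may thus be replaced by its conditional mean
    ([orthogonal_bounded], [mean_gain_ge]). The entries of the preconditioner
    are at least the lower bound used as a weight, which yields the weighted
    squared gradients, up to the bias counted in b1. The momenta satisfy
    E |m_n|^2 <= (1 - rho1^n) M_n by convexity, where M_n is the bound on the
    second moment of the samples. The coefficients then fit into b0, b2 and b3
    by the arithmetic-geometric inequality rho1 L <= 1/2 + rho1^2 L^2 / 2
    ([squares_budget]). Finally the random index is averaged out by independence
    ([mean_random_index]). *)

(** * Euclidean geometry *)

Section euclid.
Context {R : realType} {d : nat}.
Implicit Types u v w : 'cV[R]_d.

Definition dot u v : R := \sum_(i < d) u i 0 * v i 0.

Lemma dotC u v : dot u v = dot v u.
Proof. by apply: eq_bigr => i _; rewrite mulrC. Qed.

Lemma dotDl u v w : dot (u + v) w = dot u w + dot v w.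
Proof.
by rewrite -big_split; apply: eq_bigr => i _; rewrite !mxE mulrDl.
Qed.

Lemma dotZl a u w : dot (a *: u) w = a * dot u w.
Proof. by rewrite mulr_sumr; apply: eq_bigr => i _; rewrite !mxE mulrA. Qed.

Lemma dotBl u v w : dot (u - v) w = dot u w - dot v w.
Proof. by rewrite -scaleN1r dotDl dotZl mulN1r. Qed.

Lemma sqr_enorm u : enorm u ^+ 2 = \sum_(i < d) u i 0 ^+ 2.
Proof. by rewrite sqr_sqrtr // sumr_ge0 // => i _; rewrite sqr_ge0. Qed.

Lemma dotxx u : dot u u = enorm u ^+ 2.
Proof. by rewrite sqr_enorm; apply: eq_bigr => i _; rewrite expr2. Qed.

Lemma enorm_ge0 u : 0 <= enorm u.
Proof. exact: sqrtr_ge0. Qed.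

Lemma coord_le_enorm u i : `|u i 0| <= enorm u.
Proof.
rewrite -ler_sqr ?nnegrE ?enorm_ge0 // real_normK ?num_real // sqr_enorm.
by rewrite (bigD1 i) //= lerDl sumr_ge0 // => j _; rewrite sqr_ge0.
Qed.

Lemma enormZ a u : enorm (a *: u) = `|a| * enorm u.
Proof.
apply/eqP; rewrite -(@eqrXn2 _ 2) ?mulr_ge0 ?enorm_ge0 //.
rewrite exprMn real_normK ?num_real // !sqr_enorm mulr_sumr.
by apply/eqP/eq_bigr => i _; rewrite !mxE exprMn.
Qed.

Lemma enorm0 : enorm (0 : 'cV[R]_d) = 0.
Proof. by rewrite -(scale0r 0) enormZ normr0 mul0r. Qed.

Lemma enormN u : enorm (- u) = enorm u.
Proof. by rewrite -scaleN1r enormZ normrN1 mul1r. Qed.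

Lemma dot_le_enorm u v : dot u v <= enorm u * enorm v.
Proof.
have [v0|v0] := eqVneq (enorm v) 0.
  rewrite v0 mulr0 /dot big1 // => i _.
  have := coord_le_enorm v i; rewrite v0 normr_le0 => /eqP ->.
  by rewrite mulr0.
have vp : 0 < enorm v by rewrite lt_def v0 enorm_ge0.
have [u0|u0] := eqVneq (enorm u) 0.
  rewrite u0 mul0r /dot big1 // => i _.
  have := coord_le_enorm u i; rewrite u0 normr_le0 => /eqP ->.
  by rewrite mul0r.
have up : 0 < enorm u by rewrite lt_def u0 enorm_ge0.
have : 0 <= enorm (enorm v *: u - enorm u *: v) ^+ 2 by rewrite sqr_ge0.
rewrite -dotxx dotBl !dotZl ![dot _ (_ - _)]dotC !dotBl !dotZl !dotxx [dot v u]dotC.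
set a := enorm u; set b := enorm v; set x := dot u v => h.
have ab : 0 < a * b by rewrite mulr_gt0.
rewrite -(ler_pM2l ab).
have : 0 <= 2 * (a * b * (a * b) - a * b * x) by apply: (le_trans h); lra.
lra.
Qed.

Lemma norm_dot_le_enorm u v : `|dot u v| <= enorm u * enorm v.
Proof.
rewrite ler_norml dot_le_enorm andbT lerNl.
have := dot_le_enorm (- u) v; rewrite enormN.
by rewrite -scaleN1r dotZl mulN1r.
Qed.

Lemma enormD u v : enorm (u + v) <= enorm u + enorm v.
Proof.
rewrite -ler_sqr ?nnegrE ?addr_ge0 ?enorm_ge0 //.
rewrite -dotxx dotDl ![dot _ (_ + _)]dotC !dotDl !dotxx [dot v u]dotC.
have := dot_le_enorm u v; nra.
Qed.

Lemma enormB u v : enorm (u - v) <= enorm u + enorm v.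
Proof. by rewrite -[enorm v]enormN enormD. Qed.

Lemma enorm_sum (I : Type) (s : seq I) (f : I -> 'cV[R]_d) :
  enorm (\sum_(i <- s) f i) <= \sum_(i <- s) enorm (f i).
Proof.
elim/big_ind2 : _ => [|x a y b ha hb|//]; first by rewrite enorm0.
by apply: (le_trans (enormD _ _)); apply: lerD.
Qed.

Lemma l1_le_enorm u : \sum_(i < d) `|u i 0| <= Num.sqrt d%:R * enorm u.
Proof.
have := dot_le_enorm (\col_i `|u i 0|) (const_mx 1).
have -> : dot (\col_i `|u i 0|) (const_mx 1) = \sum_(i < d) `|u i 0|.
  by apply: eq_bigr => i _; rewrite !mxE mulr1.
have -> : enorm (\col_i `|u i 0|) = enorm u.
  congr Num.sqrt; apply: eq_bigr => i _.
  by rewrite mxE real_normK ?num_real.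
have -> // : enorm (const_mx 1 : 'cV[R]_d) = Num.sqrt d%:R.
  congr Num.sqrt; under eq_bigr do rewrite mxE expr1n.
  by rewrite sumr_const card_ord.
by rewrite mulrC.
Qed.

Lemma enorm_le_l1 u : enorm u <= \sum_(i < d) `|u i 0|.
Proof.
rewrite -ler_sqr ?nnegrE ?enorm_ge0 ?sumr_ge0 //.
rewrite sqr_enorm expr2 mulr_suml; apply: ler_sum => i _.
rewrite -real_normK ?num_real // expr2 ler_wpM2l //.
by rewrite (bigD1 i) //= lerDl sumr_ge0.
Qed.

End euclid.

(** * Smooth functions *)

Section smooth.
Context {R : realType} {d : nat}.
Variable V : 'cV[R]_d -> R.
Hypothesis V_diff : forall x, differentiable (V : 'cV[R]_d -> R^o) x.

Lemma derive_dot_grad x v : 'D_v (V : _ -> R^o) x = dot (grad V x) v.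
Proof.
rewrite deriveE //.
have {1}-> : v = \sum_(i < d) v i 0 *: delta_mx i 0.
  by rewrite {1}[v]matrix_sum_delta; apply: eq_bigr => i _; rewrite big_ord1.
rewrite linear_sum; apply: eq_bigr => i _.
by rewrite linearZ /= mxE deriveE // mulrC.
Qed.

Lemma is_derive_line x v (t : R) :
  is_derive t 1 (fun s : R => V (x + s *: v)) (dot (grad V (x + t *: v)) v).
Proof.
have E : (fun h : R => h^-1 *: (((fun s : R => (V (x + s *: v) : R^o)) \o shift t)
             (h *: 1) - V (x + t *: v))) =
         (fun h : R => h^-1 *: (((V : _ -> R^o) \o shift (x + t *: v)) (h *: v)
             - V (x + t *: v))).
  apply/funext => h /=; congr (_ *: (V _ - _)).
  have -> : h *: (1 : R) = h by exact: mulr1.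
  by rewrite scalerDl addrCA.
split.
  by rewrite /derivable E; apply: diff_derivable.
by rewrite /derive E -derive_dot_grad.
Qed.

Context {L : R}.
Hypothesis gradV_lip : forall x y,
  enorm (grad V x - grad V y) <= L * enorm (x - y).

(** The quadratic upper bound is the monotonicity on [0, 1] of the gap
    between V and its quadratic model along the segment: by the Lipschitz
    bound, the derivative of that gap is nonpositive. *)
Lemma descent_lemma x v :
  V (x + v) <= V x + dot (grad V x) v + L / 2 * enorm v ^+ 2.
Proof.
pose f (t : R) := V (x + t *: v) - (t * dot (grad V x) v
                 + t ^+ 2 * (L / 2 * enorm v ^+ 2)).
pose f' (t : R) := dot (grad V (x + t *: v)) v - (dot (grad V x) v
                 + t * (L * enorm v ^+ 2)).
have df (t : R) : is_derive t 1 f (f' t).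
  have /= hV := is_derive_line x v t.
  rewrite /f /f'; apply: is_deriveB.
  by apply: is_derive_eq; rewrite /GRing.scale /=; field.
have f'le0 (t : R) : t \in `]0, 1[%R -> derive1 f t <= 0.
  rewrite in_itv /= => /andP[t0 _].
  rewrite derive1E (@derive_val _ _ _ _ _ _ _ (df t)) /f' opprD addrA -dotBl subr_le0.
  apply: (le_trans (dot_le_enorm _ _)).
  have := gradV_lip (x + t *: v) x; rewrite addrAC subrr add0r enormZ gtr0_norm // => h.
  have := enorm_ge0 v; nra.
have cf : {within `[0, 1], continuous f}.
  apply: continuous_subspaceT => t; apply: differentiable_continuous.
  by apply/derivable1_diffP; have [] := df t.
have : f 1 <= f 0.
  have df1 (t : R) : t \in `]0, 1[%R -> derivable f t 1 by move=> _; have [] := df t.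
  by apply: (ler0_derive1_le_cc df1 f'le0 cf) => //; rewrite in_itv /= ?lexx ?ler01.
rewrite /f scale1r scale0r addr0 !mul0r !mul1r expr0n /= mul0r expr1n; lra.
Qed.

End smooth.

(** * The potential of one coordinate *)

Section scalar.
Context {R : realType}.
Implicit Types a x y G rho kap s : R.

(** The inequality 2 |x| <= kap + s x^2, weighted by [a]. The weight stays in both
    terms, so that for a drift [a] the first one telescopes; [kap] is the largest
    possible entry of the preconditioner. *)
Lemma weighted_young G kap s D a x :
  0 < kap -> s * kap = 1 -> `|D| <= G -> 0 <= a ->
  D * (a * x) <= G * (a * kap / 2 + a * s * x ^+ 2 / 2).
Proof.
move=> kap0 sk DG a0.
have s0 : 0 < s by rewrite -(pmulr_lgt0 _ kap0) sk.
have x1 : `|x| <= kap / 2 + s * x ^+ 2 / 2.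
  rewrite -(real_normK (num_real x)) -(ler_pM2l s0).
  have := sqr_ge0 (s * `|x| - 1); set X := `|x|.
  have -> : s * (kap / 2 + s * X ^+ 2 / 2) = 1 / 2 + (s * X) ^+ 2 / 2.
    by rewrite mulrDr mulrA sk exprMn; field.
  rewrite sqrrB1; lra.
have -> : a * kap / 2 + a * s * x ^+ 2 / 2 = a * (kap / 2 + s * x ^+ 2 / 2) by ring.
apply: (le_trans (ler_norm _)); rewrite !normrM (ger0_norm a0).
by rewrite ler_pM ?mulr_ge0 // ler_wpM2l.
Qed.

Lemma convex_sqr rho x y : 0 <= rho < 1 ->
  (rho * x + (1 - rho) * y) ^+ 2 <= rho * x ^+ 2 + (1 - rho) * y ^+ 2.
Proof.
move=> /andP[r0 r1].
have : 0 <= rho * (1 - rho) * (x - y) ^+ 2.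
  by apply: mulr_ge0 (sqr_ge0 _); apply: mulr_ge0 => //; lra.
nra.
Qed.

(** What one coordinate adds to V in the potential, for a step size [ga], an entry
    [a] of the preconditioner, a partial derivative [D] and a momentum [x]. The
    first term is the pairing that telescopes; the two others pay for the drift
    of [ga * a], through the two terms of [weighted_young]. *)
Definition potential rho G kap s ga a D x : R :=
  - (rho / (1 - rho) * D * (ga * a * x)) + G * kap / 2 / (1 - rho) * a
  + rho / (1 - rho) * G * s / 2 * (ga * (ga * a) * x ^+ 2).

(** The pairing is itself bounded by [weighted_young], with the whole entry [a] as
    a weight: the last term of the potential is then used up, and the middle one
    still leaves [G * kap / 2 * a]. *)
Lemma potential_ge0 rho G kap s ga a D x : 0 <= rho < 1 -> 0 < kap ->
  s * kap = 1 -> `|D| <= G -> 0 <= a -> 0 <= potential rho G kap s ga a D x.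
Proof.
move=> /andP[r0 r1] kap0 sk DG a0.
have G0 : 0 <= G by apply: le_trans DG.
have y := weighted_young G kap s D a (ga * x) kap0 sk DG a0.
have c0 : 0 <= rho / (1 - rho) by rewrite divr_ge0 // subr_ge0 ltW.
have r1' : 1 - rho != 0 by rewrite subr_eq0 gt_eqF.
rewrite /potential.
have -> : G * kap / 2 / (1 - rho) * a =
   rho / (1 - rho) * (G * (a * kap / 2)) + G * kap / 2 * a by field.
have h : 0 <= G * kap / 2 * a by rewrite !mulr_ge0 // ltW.
have := ler_wpM2l c0 y; rewrite exprMn; nra.
Qed.

(** The left side has the old entry [a] because it must not depend on the sample
    [y]; its replacement by [a'] and the drift of [ga * a] are the two uses of
    [weighted_young]. The factor [1 - ga' ^+ 2 / ga ^+ 2] is the part of the drift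
    that is due to the step size and does not telescope. *)
Lemma potential_step rho G kap s ga ga' a a' D D' x x' y :
  0 <= rho < 1 -> x' = rho * x + (1 - rho) * y ->
  0 < kap -> s * kap = 1 -> 0 < ga' -> ga' <= ga ->
  0 <= a' -> a' <= a -> a <= kap -> `|D'| <= G ->
  ga' * (D' * a * y) <=
    D' * (ga' * a' * x') - rho / (1 - rho) * ((D' - D) * (ga * a * x))
    + (potential rho G kap s ga a D x - potential rho G kap s ga' a' D' x')
    + rho * G / (2 * (1 - rho)) * kap ^+ 2 * (1 - ga' ^+ 2 / ga ^+ 2)
    + G * (1 + rho) / 2 * (ga' ^+ 2 * y ^+ 2).
Proof.
move=> rP x'E kap0 sk ga'0 gaga a'0 aa ak DG; have /andP[r0 r1] := rP.
have G0 : 0 <= G by apply: le_trans DG.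
have s0 : 0 < s by rewrite -(pmulr_lgt0 _ kap0) sk.
have ga0 : 0 < ga := lt_le_trans ga'0 gaga.
have r1' : 1 - rho != 0 by rewrite subr_eq0 gt_eqF.
set c := rho / (1 - rho).
have c0 : 0 <= c by rewrite divr_ge0 // subr_ge0 ltW.
have cE : c * (1 - rho) = rho by rewrite /c divfK.
set r := ga' / ga.
have rga : ga * r = ga' by rewrite /r mulrCA divff ?mulr1 // gt_eqF.
have r00 : 0 <= r by rewrite divr_ge0 // ltW.
have r11 : r <= 1 by rewrite ler_pdivrMr // mul1r.
have a0 : 0 <= a by apply: le_trans aa.
(* From [a] to [a']: the squared sample has weight 1 / 2 since [(a - a') * s <= 1]. *)
have h1 : D' * ((a - a') * (ga' * y)) <=
    G * ((a - a') * kap / 2) + G / 2 * (ga' ^+ 2 * y ^+ 2).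
  apply: (le_trans (weighted_young _ _ _ _ _ _ kap0 sk DG _)); first by rewrite subr_ge0.
  rewrite mulrDr lerD2l -mulrA [G / 2 * _]mulrAC -[G * _ / 2]mulrA ler_wpM2l //.
  rewrite exprMn mulrA ler_wpM2r ?invr_ge0 //.
  have as1 : (a - a') * s <= 1.
    by rewrite -[leRHS]sk [leRHS]mulrC ler_wpM2r ?(ltW s0) //; lra.
  have Y0 : 0 <= ga' ^+ 2 * y ^+ 2 by apply: mulr_ge0; exact: sqr_ge0.
  by rewrite -[leRHS]mul1r ler_wpM2r.
(* The drift of [ga * a], written as [ga] times a drift of entries. *)
have ra' : r * a' <= a' by rewrite ler_piMl.
have h2 : D' * ((ga * a - ga' * a') * x) <=
    G * ((a - a' + (1 - r ^+ 2) * kap) * kap / 2)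
    + G * (s / 2) * (ga * (ga * a - ga' * a') * x ^+ 2).
  have -> : (ga * a - ga' * a') * x = (a - r * a') * (ga * x).
    by rewrite -rga; ring.
  apply: (le_trans (weighted_young _ _ _ _ _ _ kap0 sk DG _)); first by lra.
  rewrite mulrDr; apply: lerD; last by rewrite -rga exprMn; lra.
  rewrite ler_wpM2l // ler_wpM2r ?invr_ge0 // ler_wpM2r ?(ltW kap0) //.
  have : 0 <= (1 - r) * (kap - a') by rewrite mulr_ge0; lra.
  have : 0 <= (1 - r) * r * kap by apply: mulr_ge0 (ltW kap0); apply: mulr_ge0; lra.
  nra.
(* The old energy has two parts: one of weight [ga * a - ga' * a'], which is spent
   in [h2], and one of weight [ga' * a'], which dominates the new energy up to the
   fraction 1 - rho of the squared sample that convexity brings in. *)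
have h3 : ga' * (ga' * a') * x' ^+ 2 <=
    ga * (ga' * a') * x ^+ 2 + (1 - rho) * kap * (ga' ^+ 2 * y ^+ 2).
  rewrite x'E.
  have w0 : 0 <= ga' * (ga' * a') by rewrite !mulr_ge0 // ?(ltW ga'0).
  apply: (le_trans (ler_wpM2l w0 (convex_sqr _ x y rP))).
  rewrite mulrDr; apply: lerD.
    rewrite [leLHS]mulrA ler_wpM2r ?sqr_ge0 // -[leRHS]mulr1.
    rewrite ler_pM ?mulr_ge0 ?(ltW ga'0) ?(ltW r1) //.
    by rewrite ler_wpM2r // mulr_ge0 // ltW.
  have -> : ga' * (ga' * a') * ((1 - rho) * y ^+ 2) =
     (1 - rho) * a' * (ga' ^+ 2 * y ^+ 2) by ring.
  have Y0 : 0 <= ga' ^+ 2 * y ^+ 2 by apply: mulr_ge0; exact: sqr_ge0.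
  by rewrite ler_wpM2r // ler_wpM2l ?(le_trans aa) // subr_ge0 ltW.
have h2c := ler_wpM2l c0 h2.
have cGs : 0 <= c * G * s / 2 by rewrite divr_ge0 // mulr_ge0 ?(ltW s0) // mulr_ge0.
have h3c := ler_wpM2l cGs h3.
rewrite -expr_div_n -/r.
have yE : ga' * (D' * a * y) = D' * ((a - a') * (ga' * y)) + D' * (ga' * a' * y)
  by ring.
have E1 : D' * (ga' * a' * y) =
   D' * (ga' * a' * x') - c * ((D' - D) * (ga * a * x))
   - c * D * (ga * a * x) + c * D' * (ga' * a' * x')
   + c * (D' * ((ga * a - ga' * a') * x)).
  have yx : y = x' + c * (x' - x).
    by rewrite x'E /c; field.
  rewrite {1}yx; ring.
have E2 : G * kap / 2 / (1 - rho) = G * kap / 2 * (1 + c).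
  by rewrite /c; field.
have E3 : rho * G / (2 * (1 - rho)) = c * G / 2.
  by rewrite /c; field.
have E4 : c * G * s / 2 * ((1 - rho) * kap * (ga' ^+ 2 * y ^+ 2)) =
   G * rho / 2 * (ga' ^+ 2 * y ^+ 2).
  transitivity ((c * (1 - rho)) * (s * kap) * G / 2 * (ga' ^+ 2 * y ^+ 2)); first by ring.
  by rewrite cE sk; ring.
rewrite /potential -/c E2 E3 yE E1.
rewrite mulrDr E4 in h3c.
set Y := ga' ^+ 2 * y ^+ 2 in h1 h3c *.
lra.
Qed.

End scalar.

(** * Pathwise analysis of the recursion *)

Section path.
Context {R : realType} {d : nat}.
Variables (rho1 rho2 delta : R) (gamma eps : nat -> R).
Hypothesis rho1P : 0 <= rho1 < 1.
Hypothesis rho2P : 0 <= rho2 < 1.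
Hypothesis delta_gt0 : 0 < delta.
Hypothesis gamma_gt0 : forall n, (1 <= n)%N -> 0 < gamma n.
Hypothesis gamma_noninc : forall n m, (1 <= n <= m)%N -> gamma m <= gamma n.
Hypothesis eps_gt0 : forall n, (1 <= n)%N -> 0 < eps n.
Hypothesis eps_nondec : forall n m, (1 <= n <= m)%N -> eps n <= eps m.
Variables (theta0 : 'cV[R]_d) (s : nat -> amsgrad_state (R := R) (d := d))
  (g : nat -> 'cV[R]_d).
Hypothesis s0 : s 0%N = AmsgradState theta0 0 0 0.
Hypothesis sS : forall n,
  s n.+1 = amsgrad_step rho1 rho2 delta gamma eps n (s n) (g n.+1).

(** The state at time n carries the quantities of time n - 1: these are the
    diagonal entries of A_(n-1), and they are functions of g_1, ..., g_n. *)
Definition precond n (i : 'I_d) : R :=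
  (Num.sqrt (delta + max_second_moment (s n) i i))^-1.

Let kap := (Num.sqrt delta)^-1.
Let th n := iterate (s n).
Let m n := momentum (s n).
Let a := precond.

Definition update n : 'cV[R]_d := \col_i (gamma n * a n i * m n i 0).

Lemma momentum0 : m 0%N = 0. Proof. by rewrite /m s0. Qed.

Lemma momentumS n : m n.+1 = rho1 *: m n + (1 - rho1) *: g n.+1.
Proof. by rewrite /m sS. Qed.

Lemma second_momentS n i : second_moment (s n.+1) i i =
  rho2 * second_moment (s n) i i + (1 - rho2) * Num.min (eps n.+1) (g n.+1 i 0 ^+ 2).
Proof.
rewrite sS /= !mxE eqxx !mulr1n; congr (_ + _ * _).
by rewrite big_ord1 mxE -expr2.
Qed.

Lemma max_second_momentS n i : max_second_moment (s n.+1) i i =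
  Num.max (max_second_moment (s n) i i) (second_moment (s n.+1) i i).
Proof. by rewrite sS /= !mxE eqxx !mulr1n. Qed.

(** The truncation bounds every average by the last level [eps n], since the
    levels increase and the weights of the average sum to 1 - rho2^n. *)
Lemma second_moment_bound n i :
  0 <= second_moment (s n) i i <= eps n * (1 - rho2 ^+ n).
Proof.
have /andP[r0 r1] := rho2P.
elim: n => [|n /andP[IH1 IH2]]; first by rewrite s0 mxE expr0 subrr mulr0 lexx.
rewrite second_momentS; apply/andP; split.
  rewrite addr_ge0 ?mulr_ge0 ?subr_ge0 ?(ltW r1) //.
  by rewrite le_min sqr_ge0 (ltW (eps_gt0 _ _)).
have h1 : second_moment (s n) i i <= eps n.+1 * (1 - rho2 ^+ n).
  apply: (le_trans IH2); case: n {IH1 IH2} => [|n]; first by rewrite expr0 subrr !mulr0.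
  rewrite ler_wpM2r ?eps_nondec //= ?leqnSn // subr_ge0.
  by rewrite exprn_ile1 // ltW.
have h2 : Num.min (eps n.+1) (g n.+1 i 0 ^+ 2) <= eps n.+1 by rewrite ge_min lexx.
rewrite [rho2 ^+ n.+1]exprS.
have := ler_wpM2l r0 h1; have : 0 <= 1 - rho2 by lra.
move=> h; have := ler_wpM2l h h2; lra.
Qed.

Lemma max_second_moment_bound n i :
  0 <= max_second_moment (s n) i i <= eps n * (1 - rho2 ^+ n).
Proof.
have /andP[r0 r1] := rho2P.
elim: n => [|n /andP[IH1 IH2]]; first by rewrite s0 mxE expr0 subrr mulr0 lexx.
have /andP[h1 h2] := second_moment_bound n.+1 i.
rewrite max_second_momentS le_max IH1 /= ge_max h2 andbT.
apply: (le_trans IH2); case: n {IH1 IH2 h1 h2} => [|n].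
  by rewrite expr0 subrr mulr0 mulr_ge0 ?(ltW (eps_gt0 _ _)) // expr1 subr_ge0 ltW.
apply: ler_pM; rewrite ?eps_nondec ?(ltW (eps_gt0 _ _)) //= ?leqnSn //.
  by rewrite subr_ge0 exprn_ile1 // ltW.
by rewrite lerB // exprS ler_piMl ?exprn_ge0 // ltW.
Qed.

Lemma precond_gt0 n i : 0 < a n i.
Proof.
rewrite invr_gt0 sqrtr_gt0 ltr_pwDl //.
by have /andP[] := max_second_moment_bound n i.
Qed.

Lemma precond0 i : a 0%N i = kap.
Proof. by rewrite /a /precond s0 mxE addr0. Qed.

Lemma precond_noninc n i : a n.+1 i <= a n i.
Proof.
have /andP[h _] := max_second_moment_bound n i.
rewrite lef_pV2 ?posrE ?sqrtr_gt0 ?ltr_pwDl //; last first.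
  by have /andP[] := max_second_moment_bound n.+1 i.
by rewrite ler_wsqrtr // lerD2l max_second_momentS le_max lexx.
Qed.

Lemma precond_le n i : a n i <= kap.
Proof.
by elim: n => [|n IH]; rewrite ?precond0 // (le_trans (precond_noninc _ _)).
Qed.

Lemma eps_low_le_precond n i : eps_low rho2 delta eps n <= a n i.
Proof.
case: n => [|n]; first exact: ltW (precond_gt0 _ _).
have /andP[h1 h2] := max_second_moment_bound n.+1 i.
rewrite /eps_low lef_pV2 ?posrE ?sqrtr_gt0 ?ltr_pwDl ?(le_trans h1) //.
by rewrite ler_wsqrtr // lerD2l.
Qed.

Lemma iterateS n : th n.+1 = th n - update n.+1.
Proof.
rewrite /th sS /= /diag_invsqrt mul_diag_mx; congr (_ - _); apply/colP => i.
rewrite /update [RHS]mxE /a /precond momentumS max_second_momentS second_momentS.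
by rewrite !mxE eqxx !mulr1n big_ord1 mxE -expr2; exact: mulrA.
Qed.

(** The momentum without the contribution of the first sample. *)
Definition tail n : 'cV[R]_d := m n - ((1 - rho1) * rho1 ^+ n.-1) *: g 1%N.
Definition tail_update n : 'cV[R]_d := \col_i (gamma n * a n i * tail n i 0).

Lemma tail1 : tail 1 = 0.
Proof. by rewrite /tail momentumS momentum0 scaler0 add0r mulr1 subrr. Qed.

Lemma tailS n : (1 <= n)%N -> tail n.+1 = rho1 *: tail n + (1 - rho1) *: g n.+1.
Proof.
case: n => // n _; rewrite /tail momentumS scalerBr scalerA /= addrAC.
by rewrite mulrCA -exprS.
Qed.

Variables (V : 'cV[R]_d -> R) (L G Vmin : R).
Hypothesis V_diff : forall x, differentiable (V : 'cV[R]_d -> R^o) x.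
Hypothesis gradV_lip : forall x y, enorm (grad V x - grad V y) <= L * enorm (x - y).
Hypothesis gradV_bound : forall x, enorm (grad V x) <= G.
Hypothesis L_ge0 : 0 <= L.
Hypothesis V_ge : forall x, Vmin <= V x.

Let c := rho1 / (1 - rho1).

(** The gradient is taken at the iterate that precedes [th n], because the
    momentum [tail n] was last updated there. *)
Definition lyapunov n : R := V (th n) +
  \sum_(i < d) potential rho1 G kap (Num.sqrt delta) (gamma n) (a n i)
                 (grad V (th n.-1) i 0) (tail n i 0).

Definition gain n : R :=
  gamma n.+1 * \sum_(i < d) grad V (th n) i 0 * a n i * g n.+1 i 0.

Let kap_gt0 : 0 < kap. Proof. by rewrite invr_gt0 sqrtr_gt0. Qed.
Let skap : Num.sqrt delta * kap = 1.
Proof. by rewrite divff // gt_eqF // sqrtr_gt0. Qed.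
Let c_ge0 : 0 <= c.
Proof. by have /andP[r0 r1] := rho1P; rewrite divr_ge0 // subr_ge0 ltW. Qed.
Let coordG x i : `|grad V x i 0| <= G.
Proof. exact: le_trans (coord_le_enorm _ _) (gradV_bound _). Qed.

Lemma lyapunov_ge n : Vmin <= lyapunov n.
Proof.
rewrite /lyapunov -[Vmin]addr0 lerD // sumr_ge0 // => i _.
by apply: potential_ge0 => //; exact: ltW (precond_gt0 _ _).
Qed.

Lemma first_sample_part n i : m n.+1 i 0 = tail n.+1 i 0 + (1 - rho1) * rho1 ^+ n * g 1%N i 0.
Proof. by rewrite /tail !mxE subrK. Qed.

Lemma first_sample_drift n :
  - (G * kap * gamma 1%N * ((1 - rho1) * rho1 ^+ n) * \sum_(i < d) `|g 1%N i 0|) <=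
  \sum_(i < d) grad V (th n) i 0 * (gamma n.+1 * a n.+1 i *
      ((1 - rho1) * rho1 ^+ n * g 1%N i 0)).
Proof.
have /andP[r0 r1] := rho1P.
rewrite mulr_sumr -sumrN; apply: ler_sum => i _.
rewrite lerNl; apply: (le_trans (ler_norm _)); rewrite normrN !normrM.
rewrite (ger0_norm (ltW (precond_gt0 _ _))) (ger0_norm (ltW (gamma_gt0 _ _))) //.
rewrite (ger0_norm (exprn_ge0 _ r0)) (@ger0_norm _ (1 - rho1)) ?subr_ge0 ?(ltW r1) //.
have w0 : 0 <= (1 - rho1) * rho1 ^+ n * `|g 1%N i 0|.
  by rewrite !mulr_ge0 ?exprn_ge0 // subr_ge0 ltW.
rewrite !mulrA -2![leLHS]mulrA -2![leRHS]mulrA ![(1 - rho1) * _]mulrA ler_wpM2r //.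
rewrite -mulrA -[leRHS]mulrA ler_pM ?mulr_ge0 ?(ltW (precond_gt0 _ _)) ?(ltW (gamma_gt0 _ _)) //.
rewrite [leRHS]mulrC ler_pM ?(ltW (precond_gt0 _ _)) ?(ltW (gamma_gt0 _ _)) //.
  by rewrite gamma_noninc.
exact: precond_le.
Qed.

Lemma descent_step n :
  \sum_(i < d) grad V (th n) i 0 * (gamma n.+1 * a n.+1 i * tail n.+1 i 0) <=
  V (th n) - V (th n.+1) + L / 2 * enorm (update n.+1) ^+ 2
  + G * kap * gamma 1%N * ((1 - rho1) * rho1 ^+ n) * \sum_(i < d) `|g 1%N i 0|.
Proof.
have := descent_lemma _ V_diff gradV_lip (th n) (- update n.+1).
rewrite -iterateS enormN dotC -scaleN1r dotZl mulN1r dotC.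
have -> : dot (grad V (th n)) (update n.+1) =
    \sum_(i < d) grad V (th n) i 0 * (gamma n.+1 * a n.+1 i * tail n.+1 i 0)
  + \sum_(i < d) grad V (th n) i 0 * (gamma n.+1 * a n.+1 i *
      ((1 - rho1) * rho1 ^+ n * g 1%N i 0)).
  rewrite -big_split; apply: eq_bigr => i _ /=.
  by rewrite -mulrDr -mulrDr -first_sample_part [update _ _ _]mxE.
have := first_sample_drift n; lra.
Qed.

(** The gradient varies by at most L times the last update, which is bounded
    together with [tail_update] by the squares of both. *)
Lemma curvature_step n : (1 <= n)%N ->
  - \sum_(i < d) (grad V (th n) i 0 - grad V (th n.-1) i 0) * (gamma n * a n i * tail n i 0)
  <= L / 2 * (enorm (update n) ^+ 2 + enorm (tail_update n) ^+ 2).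
Proof.
case: n => // n _ /=.
have -> : \sum_(i < d) (grad V (th n.+1) i 0 - grad V (th n) i 0)
      * (gamma n.+1 * a n.+1 i * tail n.+1 i 0)
  = dot (grad V (th n.+1) - grad V (th n)) (tail_update n.+1).
  by apply: eq_bigr => i _; rewrite !mxE.
apply: (le_trans (ler_norm _)); rewrite normrN.
apply: (le_trans (norm_dot_le_enorm _ _)).
have := gradV_lip (th n.+1) (th n).
rewrite iterateS addrAC subrr add0r enormN.
move=> /(ler_wpM2r (enorm_ge0 (tail_update n.+1))) /le_trans; apply.
have := sqr_ge0 (enorm (update n.+1) - enorm (tail_update n.+1)).
move=> /(mulr_ge0 L_ge0); lra.
Qed.

Definition step_cost n : R :=
  L / 2 * enorm (update n.+1) ^+ 2
  + G * kap * gamma 1%N * ((1 - rho1) * rho1 ^+ n) * \sum_(i < d) `|g 1%N i 0|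
  + c * (L / 2 * (enorm (update n) ^+ 2 + enorm (tail_update n) ^+ 2))
  + d%:R * (rho1 * G / (2 * (1 - rho1)) * kap ^+ 2 * (1 - gamma n.+1 ^+ 2 / gamma n ^+ 2))
  + G * (1 + rho1) / 2 * (gamma n.+1 ^+ 2 * enorm (g n.+1) ^+ 2).

Lemma sum_coordinates (A B p p' y : 'I_d -> R) (k0 k1 k2 k3 : R) :
  \sum_(i < d) (A i - k0 * B i + (p i - p' i) + k1 + k2 * (k3 * y i ^+ 2)) =
  \sum_(i < d) A i - k0 * \sum_(i < d) B i
  + (\sum_(i < d) p i - \sum_(i < d) p' i) + d%:R * k1
  + k2 * (k3 * \sum_(i < d) y i ^+ 2).
Proof.
by rewrite !big_split /= !sumrN sumr_const card_ord -!mulr_sumr mulr_natl.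
Qed.

(** The sum over the coordinates of [potential_step]; the pairing of the current
    gradient with the new momentum becomes a decrease of V by [descent_step]. *)
Lemma lyapunov_step n : (1 <= n)%N ->
  gain n <= lyapunov n - lyapunov n.+1 + step_cost n.
Proof.
move=> n1.
pose D i := grad V (th n.-1) i 0.
pose D' i := grad V (th n) i 0.
have : gain n <= \sum_(i < d) (D' i * (gamma n.+1 * a n.+1 i * tail n.+1 i 0)
   - c * ((D' i - D i) * (gamma n * a n i * tail n i 0))
   + (potential rho1 G kap (Num.sqrt delta) (gamma n) (a n i) (D i) (tail n i 0)
    - potential rho1 G kap (Num.sqrt delta) (gamma n.+1) (a n.+1 i) (D' i) (tail n.+1 i 0))
   + rho1 * G / (2 * (1 - rho1)) * kap ^+ 2 * (1 - gamma n.+1 ^+ 2 / gamma n ^+ 2)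
   + G * (1 + rho1) / 2 * (gamma n.+1 ^+ 2 * g n.+1 i 0 ^+ 2)).
  rewrite /gain mulr_sumr; apply: ler_sum => i _.
  apply: potential_step; rewrite ?gamma_gt0 ?gamma_noninc ?n1 ?leqnSn ?coordG //.
  - by rewrite tailS // !mxE.
  - exact: ltW (precond_gt0 _ _).
  - exact: precond_noninc.
  - exact: precond_le.
move=> /le_trans; apply.
rewrite (sum_coordinates (fun i => D' i * _) (fun i => (D' i - D i) * _)
  (fun i => potential _ _ _ _ _ _ (D i) _) (fun i => potential _ _ _ _ _ _ (D' i) _)).
rewrite -sqr_enorm /step_cost /lyapunov.
have h1 := descent_step n; have h2 := ler_wpM2l c_ge0 (curvature_step n n1).
rewrite /D' /D; lra.
Qed.

(** The tail vanishes at time 1, so the potential starts with the term in the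
    preconditioner alone; it gives the term in d G of b0. *)
Lemma lyapunov1 :
  lyapunov 1 <= V theta0 + d%:R * (G * kap ^+ 2 / 2 / (1 - rho1))
    + L / 2 * enorm (update 1) ^+ 2
    + G * kap * gamma 1%N * (1 - rho1) * \sum_(i < d) `|g 1%N i 0|.
Proof.
have th0 : th 0%N = theta0 by rewrite /th s0.
have /andP[r0 r1] := rho1P.
have := descent_step 0; rewrite tail1 th0 expr0 mulr1.
rewrite big1 => [|i _]; last by rewrite !mxE !mulr0.
have : lyapunov 1 <= V (th 1%N) + d%:R * (G * kap ^+ 2 / 2 / (1 - rho1)).
  rewrite /lyapunov lerD2l mulr_natl -[d in leRHS]card_ord -sumr_const.
  apply: ler_sum => i _; rewrite /potential tail1 !mxE expr0n /= !mulr0 oppr0 add0r addr0.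
  have G0 : 0 <= G by apply: le_trans (coordG theta0 i).
  have k0 : 0 <= G * kap / 2 / (1 - rho1).
    by rewrite divr_ge0 ?subr_ge0 ?(ltW r1) // divr_ge0 // mulr_ge0 // ltW.
  have := ler_wpM2l k0 (precond_le 1 i); move=> /le_trans; apply.
  by rewrite expr2; lra.
lra.
Qed.

(** The contributions of the first sample to all the momenta add up to at most
    one full update, because their weights form a geometric series. *)
Lemma gain_sum N :
  \sum_(1 <= n < N.+1) gain n <= V theta0 - Vmin
    + d%:R * (G * kap ^+ 2 / 2 / (1 - rho1))
    + G * kap * gamma 1%N * \sum_(i < d) `|g 1%N i 0|
    + L / 2 * \sum_(1 <= n < N.+2) enorm (update n) ^+ 2
    + c * (L / 2) * \sum_(1 <= n < N.+1) (enorm (update n) ^+ 2 + enorm (tail_update n) ^+ 2)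
    + d%:R * (rho1 * G / (2 * (1 - rho1)) * kap ^+ 2)
      * \sum_(1 <= n < N.+1) (1 - gamma n.+1 ^+ 2 / gamma n ^+ 2)
    + G * (1 + rho1) / 2 * \sum_(1 <= n < N.+1) gamma n.+1 ^+ 2 * enorm (g n.+1) ^+ 2.
Proof.
have /andP[r0 r1] := rho1P.
set w := \sum_(i < d) `|_|.
suff : \sum_(1 <= n < N.+1) gain n + lyapunov N.+1 <= V theta0
    + d%:R * (G * kap ^+ 2 / 2 / (1 - rho1))
    + G * kap * gamma 1%N * (1 - rho1 ^+ N.+1) * w
    + L / 2 * \sum_(1 <= n < N.+2) enorm (update n) ^+ 2
    + c * (L / 2) * \sum_(1 <= n < N.+1) (enorm (update n) ^+ 2 + enorm (tail_update n) ^+ 2)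
    + d%:R * (rho1 * G / (2 * (1 - rho1)) * kap ^+ 2)
      * \sum_(1 <= n < N.+1) (1 - gamma n.+1 ^+ 2 / gamma n ^+ 2)
    + G * (1 + rho1) / 2 * \sum_(1 <= n < N.+1) gamma n.+1 ^+ 2 * enorm (g n.+1) ^+ 2.
  have := lyapunov_ge N.+1.
  have G0 : 0 <= G := le_trans (enorm_ge0 _) (gradV_bound theta0).
  have w0 : 0 <= G * kap * gamma 1%N * rho1 ^+ N.+1 * w.
    rewrite mulr_ge0 ?sumr_ge0 // mulr_ge0 ?exprn_ge0 // mulr_ge0 ?(ltW (gamma_gt0 _ _)) //.
    by rewrite mulr_ge0 // ltW.
  lra.
elim: N => [|N IH].
  rewrite ![\sum_(1 <= n < 1) _]big_geq // big_nat1 add0r !mulr0 !addr0 expr1.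
  by have := lyapunov1; rewrite -/w; lra.
rewrite ![\sum_(1 <= n < N.+2) _](@big_nat_recr _ _ _ N.+1) //=.
rewrite (@big_nat_recr _ _ _ N.+2) //=.
have := lyapunov_step N.+1 isT; rewrite /step_cost -/w [rho1 ^+ N.+2]exprS.
rewrite (@big_nat_recr _ _ _ N.+1) //= in IH *.
move: IH; set S1 := (\sum_(1 <= n < N.+1) gain n).
set S2 := (\sum_(1 <= n < N.+1) enorm (update n) ^+ 2).
set S3 := (\sum_(1 <= n < N.+1) (enorm (update n) ^+ 2 + _)).
set S4 := (\sum_(1 <= n < N.+1) (1 - _)).
set S5 := (\sum_(1 <= n < N.+1) (_ * _)).
lra.
Qed.

End path.

(** * Bounded random variables *)

Section bounded_random_variables.
Context {R : realType} {dT : measure_display} {T : measurableType dT}.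

(** The samples, the momenta and the gradients at the iterates are of this kind.
    The class is closed under the ring operations, and the mean is linear on it. *)
Definition bounded_measurable (f : T -> R) : Prop :=
  measurable_fun [set: T] f /\ exists C, forall w, `|f w| <= C.

Lemma bm_cst (k : R) : bounded_measurable (fun=> k).
Proof. by split; [exact: measurable_cst|exists `|k|]. Qed.

Lemma bmD f g : bounded_measurable f -> bounded_measurable g ->
  bounded_measurable (fun w => f w + g w).
Proof.
move=> [mf [C fC]] [mg [C' gC]]; split; first exact: measurable_funD.
by exists (C + C') => w; apply: (le_trans (ler_normD _ _)); apply: lerD.
Qed.

Lemma bmM f g : bounded_measurable f -> bounded_measurable g ->
  bounded_measurable (fun w => f w * g w).
Proof.
move=> [mf [C fC]] [mg [C' gC]]; split; first exact: measurable_funM.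
by exists (C * C') => w; rewrite normrM ler_pM.
Qed.

Lemma bmZ (k : R) f : bounded_measurable f -> bounded_measurable (fun w => k * f w).
Proof. by apply: bmM; exact: bm_cst. Qed.

Lemma bmN f : bounded_measurable f -> bounded_measurable (fun w => - f w).
Proof. by move=> [mf [C fC]]; split; [exact: measurable_funN|exists C => w; rewrite normrN]. Qed.

Lemma bmB f g : bounded_measurable f -> bounded_measurable g ->
  bounded_measurable (fun w => f w - g w).
Proof. by move=> bf /bmN; exact: bmD. Qed.

Lemma bmX f n : bounded_measurable f -> bounded_measurable (fun w => f w ^+ n).
Proof.
move=> bf; elim: n => [|n IH]; first exact: bm_cst.
by under eq_fun do rewrite exprS; exact: bmM.
Qed.

Lemma bm_norm f : bounded_measurable f -> bounded_measurable (fun w => `|f w|).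
Proof.
move=> [mf [C fC]]; split; first exact: measurableT_comp.
by exists C => w; rewrite normr_id.
Qed.

Lemma bm_sum (I : Type) (s : seq I) (p : pred I) (f : I -> T -> R) :
  (forall i, p i -> bounded_measurable (f i)) ->
  bounded_measurable (fun w => \sum_(i <- s | p i) f i w).
Proof.
move=> bf; elim: s => [|i s IH].
  by under eq_fun do rewrite big_nil; exact: bm_cst.
under eq_fun do rewrite big_cons.
by case pi: (p i) => //; apply: bmD => //; exact: bf.
Qed.

Variable P : probability T R.

Lemma bm_integrable f : bounded_measurable f -> P.-integrable [set: T] (EFin \o f).
Proof.
move=> [mf [C fC]]; apply: measurable_bounded_integrable => //.
  by apply: (le_lt_trans (probability_le1 P measurableT)); rewrite ltry.
exists C; split; first exact: num_real.
by move=> M CM w _; exact: le_trans (fC w) (ltW CM).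
Qed.

Lemma integrable_bmM f U : bounded_measurable f ->
  P.-integrable [set: T] (EFin \o U) ->
  P.-integrable [set: T] (EFin \o (fun w => f w * U w)).
Proof.
move=> [mf [C fC]] iU.
have mU : measurable_fun [set: T] U.
  by apply/measurable_EFinP; exact: measurable_int iU.
apply: (le_integrable _ _ _ (integrableZl measurableT C iU)) => //.
  by apply/measurable_EFinP; exact: measurable_funM.
move=> w _ /=; rewrite lee_fin !normrM ler_wpM2r //.
exact: le_trans (fC w) (ler_norm _).
Qed.

Definition mean (f : T -> R) : R := (\int[P]_w f w)%R.

Lemma mean_cst k : mean (fun=> k) = k.
Proof.
rewrite /mean Rintegral_cst // [X in _ * X](_ : _ = 1) ?mulr1 //.
by transitivity (fine (1%:E : \bar R)) => //; congr fine; exact: probability_setT.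
Qed.

Lemma meanD f g : bounded_measurable f -> bounded_measurable g ->
  mean (fun w => f w + g w) = mean f + mean g.
Proof. by move=> bf bg; apply: RintegralD => //; exact: bm_integrable. Qed.

Lemma meanB f g : bounded_measurable f -> bounded_measurable g ->
  mean (fun w => f w - g w) = mean f - mean g.
Proof. by move=> bf bg; apply: RintegralB => //; exact: bm_integrable. Qed.

Lemma meanZ k f : bounded_measurable f -> mean (fun w => k * f w) = k * mean f.
Proof. by move=> bf; apply: RintegralZl => //; exact: bm_integrable. Qed.

Lemma mean_le f g : bounded_measurable f -> bounded_measurable g ->
  (forall w, f w <= g w) -> mean f <= mean g.
Proof. by move=> bf bg fg; apply: le_Rintegral => //; exact: bm_integrable. Qed.

(** The positive part of f - g vanishes almost everywhere. *)
Lemma mean_le_ae f g : P.-integrable [set: T] (EFin \o f) ->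
  P.-integrable [set: T] (EFin \o g) -> {ae P, forall w, f w <= g w} ->
  mean f <= mean g.
Proof.
move=> intf intg fg; rewrite -subr_le0.
pose D w := f w - g w.
have iD : P.-integrable [set: T] (EFin \o D).
  exact: (integrableB measurableT intf intg).
rewrite /mean -RintegralB // /Rintegral -[leRHS]/(fine (0%E : \bar R)).
have mD : measurable_fun [set: T] (EFin \o D) by exact: measurable_int iD.
have D0 : (\int[P]_w ((EFin \o D)^\+ w) = 0)%E.
  rewrite (ae_eq_integral (cst 0%E)) ?integral0 //; first exact: measurable_funepos.
  apply: filterS fg => w fgw _ /=.
  by rewrite funeposE /= max_r // lee_fin subr_le0.
apply: fine_le => //; first exact: integrable_fin_num.
rewrite -D0; apply: le_integral => //; first exact: integrable_funepos.
by move=> w _; rewrite funeposE le_max lexx.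
Qed.

Lemma mean_sum (I : Type) (s : seq I) (f : I -> T -> R) :
  (forall i, bounded_measurable (f i)) ->
  mean (fun w => \sum_(i <- s) f i w) = \sum_(i <- s) mean (f i).
Proof.
move=> bf; elim: s => [|i s IH].
  by under eq_fun do rewrite big_nil; rewrite mean_cst big_nil.
under eq_fun do rewrite big_cons.
by rewrite big_cons meanD ?IH //; apply: bm_sum.
Qed.

Lemma expectation_mean f : bounded_measurable f -> ('E_P[f] = (mean f)%:E)%E.
Proof.
move=> bf; rewrite unlock /mean /Rintegral fineK //.
by apply: integrable_fin_num => //; exact: bm_integrable.
Qed.

End bounded_random_variables.

Section continuous_of_coordinates.
Context {R : realType} {d : nat} {dT : measure_display} {T : measurableType dT}.

(** The function is first evaluated at the point of a grid of mesh 1/(k+1) below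
    the vector. This takes countably many values, each on an event defined by the
    integer parts of the coordinates. The mesh then tends to 0. *)
Lemma continuous_measurable_coordinates (f : 'cV[R]_d -> R) (x : T -> 'cV[R]_d) :
  continuous f -> (forall i, measurable_fun [set: T] (fun w => x w i 0)) ->
  measurable_fun [set: T] (fun w => f (x w)).
Proof.
move=> cf mx.
pose fl (k : nat) (w : T) : 'cV[int]_d := \col_i Num.floor (k.+1%:R * x w i 0).
pose gr (k : nat) (M : 'cV[int]_d) : 'cV[R]_d := \col_i ((M i 0)%:~R / k.+1%:R).
apply: (@measurable_fun_cvg _ _ _ _ (fun k w => f (gr k (fl k w)))) => //.
  move=> k _ B mB; rewrite setTI.
  have -> : (fun w => f (gr k (fl k w))) @^-1` B =
     \bigcup_M [set w | fl k w = M /\ B (f (gr k M))].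
    by apply/seteqP; split => [w /= Bw|w [M _ [/= <-]] //]; exists (fl k w).
  apply: countable_bigcupT_measurable => [|M]; first exact: countableP.
  have [BM|nBM] := pselect (B (f (gr k M))); last first.
    by rewrite (_ : [set _ | _] = set0) // -subset0 => w [].
  have -> : [set w | fl k w = M /\ B (f (gr k M))] = \bigcap_(i in [set: 'I_d])
      ((fun w => (Num.floor (k.+1%:R * x w i 0))%:~R : R) @^-1` [set (M i 0)%:~R]).
    apply/seteqP; split => [w [flM _] i _ /=|w wM]; first by rewrite -flM mxE.
    split => //; apply/colP => i; rewrite mxE.
    by have /= /eqP := wM i I; rewrite eqr_int => /eqP.
  apply: fin_bigcap_measurable => [|i _]; first exact: finite_finset.
  have mfl : measurable_fun [set: R] (fun y : R => (Num.floor (k.+1%:R * y))%:~R : R).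
    apply: nondecreasing_measurable => // y z yz.
    by rewrite ler_int le_floor // ler_wpM2l.
  rewrite -[X in measurable X]setTI.
  have /= mg := measurableT_comp mfl (mx i).
  by apply: mg.
move=> w _.
apply: (@cvg_comp _ _ _ (fun k => gr k (fl k w)) f _ (nbhs (x w))); last exact: cf.
apply/cvg_ballP => e e0; near=> k; split => // i j.
rewrite (ord1 j) !mxE /ball /= distrC.
have k0 : 0 < k.+1%:R :> R by rewrite ltr0n.
rewrite -(ltr_pM2l k0) -{1}[k.+1%:R](gtr0_norm k0) -normrM mulrBr mulrCA divff ?gt_eqF // mulr1.
have /andP[h1 h2] := floor_itv (k.+1%:R * x w i 0).
rewrite intrD1 in h2.
have ke : 1 < k.+1%:R * e.
  rewrite -ltr_pdivrMl // mulr1.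
  by near: k; exact: (near_infty_natSinv_lt (PosNum e0)).
apply: le_lt_trans ke; rewrite ler_norml; apply/andP; split; lra.
Unshelve. all: by end_near.
Qed.

End continuous_of_coordinates.

(** * Testing against bounded measurable functions *)

Section orthogonality.
Context {R : realType}.

(** The sum is the largest multiple of [e] below [z], capped at [k * e]. *)
Lemma staircase (e : R) (k : nat) (z : R) : 0 < e -> 0 <= z ->
  \sum_(j < k) e * ((j.+1%:R * e <= z)%R)%:R <= z /\
  (z <= k%:R * e -> z - e <= \sum_(j < k) e * ((j.+1%:R * e <= z)%R)%:R).
Proof.
move=> e0; elim: k z => [|k IH] z z0.
  by rewrite big_ord0 mul0r; split => // z0'; lra.
have st0 (y : R) : 0 <= \sum_(j < k) e * ((j.+1%:R * e <= y)%R)%:R.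
  by apply: sumr_ge0 => j _; rewrite mulr_ge0 ?ler0n // ltW.
rewrite big_ord_recl /= mul1r.
have E : \sum_(j < k) e * (((lift ord0 j).+1%:R * e <= z)%R)%:R =
    \sum_(j < k) e * ((j.+1%:R * e <= z - e)%R)%:R.
  by apply: eq_bigr => j _; rewrite lift0 -[j.+2%:R]natr1 mulrDl mul1r lerBrDr.
rewrite E; have [ez|ze] := leP e z.
  rewrite mulr1; have [] := IH (z - e); first by rewrite subr_ge0.
  move=> h1 h2; split; first by lra.
  rewrite -[k.+1%:R]natr1 mulrDl mul1r -lerBlDr => /h2; lra.
rewrite mulr0 add0r [X in X <= z /\ _](_ : _ = 0); last first.
  rewrite big1 // => j _; rewrite leNgt.
  have -> : z - e < j.+1%:R * e by rewrite (@lt_trans _ _ 0) ?subr_lt0 ?mulr_gt0.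
  by rewrite mulr0.
by split => // _; have := st0 (z - e); lra.
Qed.

Context {dT : measure_display} {T : measurableType dT}.
Variable P : probability T R.

Lemma mean_sum_integrable (I : Type) (s : seq I) (f : I -> T -> R) :
  (forall i, P.-integrable [set: T] (EFin \o f i)) ->
  P.-integrable [set: T] (EFin \o (fun w => \sum_(i <- s) f i w)) /\
  mean P (fun w => \sum_(i <- s) f i w) = \sum_(i <- s) mean P (f i).
Proof.
move=> fi; elim: s => [|i s [IH1 IH2]].
  under eq_fun do rewrite big_nil; rewrite big_nil mean_cst; split => //.
  exact/bm_integrable/bm_cst.
under eq_fun do rewrite big_cons.
split; last by rewrite big_cons -IH2 /mean RintegralD.
exact: (integrableD measurableT (fi i) IH1).
Qed.

(** Testing an integrable function against a bounded function that is measurable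
    for a sigma-algebra reduces to testing it against the sets of that algebra:
    the multiplier is within e of a staircase of indicators of its upper level
    sets. *)
Lemma orthogonal_bounded (S : set (set T)) (U Z : T -> R) :
  <<s S>> `<=` @measurable _ T ->
  P.-integrable [set: T] (EFin \o U) ->
  (forall A, <<s S>> A -> (\int[P]_(w in A) U w)%R = 0) ->
  measurable_wrt <<s S>> Z -> (exists C, forall w, `|Z w| <= C) ->
  mean P (fun w => Z w * U w) = 0.
Proof.
move=> sub iU oU mZ [C0 ZC0].
pose C := `|C0|.
have ZC w : 0 <= Z w + C <= 2 * C.
  have := ler_norm C0; have := ZC0 w; rewrite ler_norml => /andP[h1 h2] h3.
  by rewrite /C; apply/andP; split; lra.
have mU : measurable_fun [set: T] U.
  by apply/measurable_EFinP; exact: measurable_int iU.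
have mZT : measurable_fun [set: T] Z by move=> _ B mB; rewrite setTI; apply: sub; exact: mZ.
have int_bound (f : T -> R) : measurable_fun [set: T] f -> (exists M, forall w, `|f w| <= M) ->
    P.-integrable [set: T] (EFin \o (fun w => f w * U w)).
  by move=> mf bf; exact: integrable_bmM.
have iabs : P.-integrable [set: T] (EFin \o (fun w => `|U w|)).
  exact: integrable_norm.
have mC : measurable_fun [set: T] (fun w => Z w + C).
  by apply: measurable_funD => //; exact: measurable_cst.
have bC : exists M, forall w, `|Z w + C| <= M.
  by exists (2 * C) => w; have /andP[h1 h2] := ZC w; rewrite ger0_norm.
have -> : mean P (fun w => Z w * U w) = mean P (fun w => (Z w + C) * U w).
  have -> : (fun w => Z w * U w) = (fun w => (Z w + C) * U w - C * U w).
    by apply/funext => w; rewrite mulrDl addrK.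
  rewrite /mean RintegralB //; [|exact: int_bound|]; last first.
    by apply: int_bound; [exact: measurable_cst|exists `|C|].
  rewrite RintegralZl // oU ?mulr0 ?subr0 //.
  exact: (@measurableT _ (g_sigma_algebraType S)).
set I1 := mean P _.
have I1e (k : nat) : `|I1| <= 2 * C / k.+1%:R * mean P (fun w => `|U w|).
  have [C00|Cn0] := eqVneq C 0.
    have -> : I1 = 0.
      rewrite /I1 (_ : (fun w => _) = fun=> 0) ?mean_cst //; apply/funext => w.
      by have := ZC w; rewrite C00 mulr0 => /le_anti; rewrite addr0 => <-; rewrite mul0r.
    by rewrite normr0 C00 mulr0 mul0r mul0r.
  have C_gt0 : 0 < C by rewrite lt_def Cn0 normr_ge0.
  set e := _ / _; have e0 : 0 < e by rewrite divr_gt0 ?mulr_gt0.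
  pose A (j : nat) : set T := [set w | j.+1%:R * e <= Z w + C].
  have GA j : <<s S>> (A j).
    rewrite (_ : A j = Z @^-1` `[j.+1%:R * e - C, +oo[%classic).
      by apply: mZ; exact: measurable_itv.
    by apply/seteqP; split => w /=; rewrite in_itv /= andbT lerBlDr.
  pose st (w : T) := \sum_(j < k.+1) e * ((j.+1%:R * e <= Z w + C)%R)%:R.
  have stE w : st w = \sum_(j < k.+1) e * (\1_(A j) w).
    apply: eq_bigr => j _; congr (_ * _); rewrite indicE; congr (_%:R).
    by congr nat_of_bool; apply/idP/idP; rewrite inE.
  have mst : measurable_fun [set: T] st.
    rewrite (_ : st = fun w => \sum_(j < k.+1) e * (\1_(A j) w)); last first.
      by apply/funext => w; rewrite stE.
    apply: (bm_sum _ _ _ _ _).1 => j _; apply: bmZ; split.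
      by apply: measurable_indic; exact: sub.
    by exists 1 => w; rewrite indicE ger0_norm ?ler0n // lern1 leq_b1.
  have st_close w : `|Z w + C - st w| <= e.
    have /andP[h1 h2] := ZC w.
    have [h3 h4] := staircase e k.+1 (Z w + C) e0 h1.
    rewrite ger0_norm ?subr_ge0 // lerBlDl -lerBlDr; apply: h4.
    by rewrite mulrC /e divfK.
  have Ist : mean P (fun w => st w * U w) = 0.
    rewrite (_ : (fun w => _) = fun w => \sum_(j < k.+1) e * (\1_(A j) w * U w)); last first.
      by apply/funext => w; rewrite stE mulr_suml; apply: eq_bigr => j _; rewrite mulrA.
    have iAU j : P.-integrable [set: T] (EFin \o (fun w => \1_(A j) w * U w)).
      apply: int_bound; first by (apply: measurable_indic; exact: sub).
      by exists 1 => w; rewrite indicE ger0_norm ?ler0n // lern1 leq_b1.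
    rewrite (mean_sum_integrable _ _ _ _).2 => [|j]; last first.
      exact: (integrableZl measurableT e (iAU j)).
    rewrite big1 // => j _; rewrite /mean RintegralZl // -[RHS](mulr0 e); congr (_ * _).
    rewrite -(oU (A j)) // [RHS]Rintegral_mkcond; apply: eq_Rintegral => w _.
    by rewrite patchE indicE; case: ifP => _; rewrite ?mul1r ?mul0r.
  have -> : I1 = mean P (fun w => (Z w + C - st w) * U w).
    rewrite (_ : (fun w => (_ - _) * _) = fun w => (Z w + C) * U w - st w * U w); last first.
      by apply/funext => w; rewrite mulrBl.
    rewrite /mean RintegralB //; [|exact: int_bound|]; last first.
      apply: int_bound => //; exists (e + 2 * C) => w.
      have -> : st w = (Z w + C) - (Z w + C - st w) by rewrite opprB addrC subrK.
      apply: (le_trans (ler_normB _ _)); rewrite addrC lerD //.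
      by have /andP[h1 h2] := ZC w; rewrite ger0_norm.
    by rewrite -/(mean P _) -/(mean P (fun w => st w * U w)) Ist subr0.
  have idiff : P.-integrable [set: T] (EFin \o (fun w => (Z w + C - st w) * U w)).
    by apply: int_bound; [exact: measurable_funB|exists e].
  apply: (le_trans (le_normr_Rintegral measurableT idiff)).
  rewrite -RintegralZl //; apply: le_Rintegral => //.
  - exact: integrable_norm.
  - exact: (integrableZl measurableT e iabs).
  - by move=> w _; rewrite normrM ler_wpM2r.
apply/eqP; rewrite -normr_le0; apply/ler_addgt0Pr => e e0; rewrite add0r.
pose M := 2 * C * mean P (fun w => `|U w|).
have [k kM] : exists k : nat, M / e < k.+1%:R.
  exists (Num.truncn (M / e)); exact: truncnS_gt.
apply: (le_trans (I1e k)).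
rewrite mulrAC -/M ler_pdivrMr ?ltr0n // mulrC -ler_pdivrMr //; exact: ltW.
Qed.

End orthogonality.

(** * Geometric levels *)

Section geometric.
Context {R : realType} {dT : measure_display} {T : measurableType dT}.
Variable P : probability T R.

Lemma bm_nat_comp (f : nat -> R) (K : {RV P >-> nat}) :
  (exists C, forall k, `|f k| <= C) -> bounded_measurable (fun w => f (K w)).
Proof.
move=> [C fC]; split; last by exists C => w.
by apply: (measurableT_comp (f := f)) => //.
Qed.

Lemma mean_indic (A : set T) : measurable A -> mean P (\1_A) = fine (P A).
Proof. by move=> mA; rewrite /mean /Rintegral integral_indic // setIT. Qed.

Lemma bm_indic (A : set T) : measurable A -> bounded_measurable (\1_A : T -> R).
Proof.
move=> mA; split; first exact: measurable_indic.
by exists 1 => w; rewrite indicE ger0_norm ?ler0n // lern1 leq_b1.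
Qed.

Lemma measurable_level (K : {RV P >-> nat}) k : measurable (K @^-1` [set k]).
Proof. by rewrite -[X in measurable X]setTI; exact: measurable_funPT. Qed.

Lemma level_indicE (K : {RV P >-> nat}) k w :
  \1_(K @^-1` [set k]) w = (K w == k)%:R :> R.
Proof.
rewrite indicE; congr (nat_of_bool _)%:R.
by apply/idP/eqP; rewrite inE.
Qed.

Variable K : {RV P >-> nat}.
Hypothesis K_geom : forall k, (1 <= k)%N -> P (K @^-1` [set k]) = ((2 ^+ k)^-1)%:E.

Let pr k : R := fine (P (K @^-1` [set k])).

Lemma sum_indic_level_le (s : seq nat) w : uniq s ->
  \sum_(k <- s) (\1_(K @^-1` [set k]) w : R) <= 1.
Proof.
move=> us; under eq_bigr do rewrite level_indicE.
have [ks|ks] := boolP (K w \in s).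
  rewrite (bigD1_seq (K w)) //= eqxx big1 ?addr0 // => j; rewrite eq_sym.
  by move/negPf => ->.
rewrite big1_seq // => j /= js; case: eqP => // Kj.
by rewrite Kj js in ks.
Qed.

Lemma sum_half_powers n : \sum_(1 <= k < n.+1) (2 ^+ k)^-1 = 1 - (2 ^+ n)^-1 :> R.
Proof.
elim: n => [|n IH]; first by rewrite big_geq // expr0 invr1 subrr.
rewrite big_nat_recr //= IH exprS invfM.
by field; rewrite expf_neq0.
Qed.

(** The levels k >= 1 already carry the whole mass 1. *)
Lemma geometric_zero : pr 0 = 0.
Proof.
have pr0 : 0 <= pr 0 by apply: fine_ge0; exact: measure_ge0.
apply/eqP; rewrite eq_le pr0 andbT; apply/ler_addgt0Pr => e e0; rewrite add0r.
have small n : pr 0 <= (2 ^+ n)^-1.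
  have : mean P (fun w => \sum_(0 <= k < n.+1) \1_(K @^-1` [set k]) w) <= 1.
    rewrite -(mean_cst P 1); apply: mean_le => [||w].
    - by apply: bm_sum => k _; apply: bm_indic; exact: measurable_level.
    - exact: bm_cst.
    - by apply: sum_indic_level_le; exact: iota_uniq.
  rewrite mean_sum => [|k]; last by apply: bm_indic; exact: measurable_level.
  have mE k : mean P \1_(K @^-1` [set k]) = pr k.
    by rewrite mean_indic //; exact: measurable_level.
  rewrite big_nat_recl //= mE.
  have -> : \sum_(0 <= i < n) mean P \1_(K @^-1` [set i.+1]) = 1 - (2 ^+ n)^-1.
    rewrite -sum_half_powers big_add1 /=; apply: eq_bigr => k _.
    by rewrite mE /pr K_geom.
  lra.
apply: (le_trans (small (Num.truncn e^-1))).
rewrite invf_ple ?posrE ?exprn_gt0 //.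
apply: (le_trans (ltW (truncnS_gt _))).
by rewrite -natrX ler_nat ltn_expl.
Qed.

(** The size 2^k of the correction of the estimator, cut at the threshold t. *)
Definition capped_level (t : R) (k : nat) : R := (2 ^ k)%:R * ((2 ^ k)%:R <= t)%R%:R.

Lemma capped_level_ge0 t k : 0 <= capped_level t k.
Proof. by rewrite mulr_ge0 ?ler0n. Qed.

Lemma bm_capped_level t : 0 <= t -> bounded_measurable (fun w => capped_level t (K w)).
Proof.
move=> t0; apply: (bm_nat_comp (capped_level t)); exists t => k.
rewrite ger0_norm ?capped_level_ge0 //.
by rewrite /capped_level; case: (leP (2 ^ k)%:R t) => h /=; rewrite ?mulr1 ?mulr0 ?ler0n.
Qed.

(** Each admissible level k >= 1 contributes 2^k * 2^-k = 1 to the mean, and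
    there are at most log_2 t of them. *)
Lemma mean_capped_level t : 1 <= t ->
  mean P (fun w => capped_level t (K w)) <= ln t / ln 2.
Proof.
move=> t1.
have t0 : 0 < t := lt_le_trans ltr01 t1.
have l2 : 0 < ln 2 :> R by rewrite ln_gt0 // ltr1n.
have lt0 : 0 <= ln t / ln 2 by apply: divr_ge0; [exact: ln_ge0|exact: ltW].
pose n := Num.truncn (ln t / ln 2).
pose f (k : nat) (w : T) : R := (2 ^ k)%:R * \1_(K @^-1` [set k]) w.
have bf k : bounded_measurable (f k).
  by apply: bmZ; apply: bm_indic; exact: measurable_level.
have le_f w : capped_level t (K w) <= \sum_(0 <= k < n.+1) f k w.
  rewrite /capped_level; case: (leP (2 ^ (K w))%:R t) => h /=; last first.
    rewrite mulr0; apply: sumr_ge0 => k _.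
    by rewrite mulr_ge0 // indicE.
  have Kn : (K w < n.+1)%N.
    rewrite ltnS /n truncn_ge_nat // ler_pdivlMr // mulr_natl -lnXn // -natrX.
    by rewrite ler_ln ?posrE // ltr0n expn_gt0.
  rewrite mulr1 (bigD1_seq (K w)) ?iota_uniq ?mem_index_iota //=.
  rewrite /f level_indicE eqxx mulr1 lerDl; apply: sumr_ge0 => k _.
  by rewrite mulr_ge0 // indicE.
apply: (@le_trans _ _ (mean P (fun w => \sum_(0 <= k < n.+1) f k w))).
  by apply: mean_le => //; [exact: bm_capped_level (ltW t0)|exact: bm_sum].
rewrite mean_sum // big_nat_recl //.
have mfE k : mean P (f k) = (2 ^ k)%:R * pr k.
  rewrite meanZ; last by apply: bm_indic; exact: measurable_level.
  by rewrite mean_indic //; exact: measurable_level.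
rewrite mfE geometric_zero mulr0 add0r.
have -> : \sum_(0 <= k < n) mean P (f k.+1) = \sum_(0 <= k < n) 1.
  by apply: eq_bigr => k _; rewrite mfE /pr K_geom //= natrX divff // expf_neq0.
by rewrite sumr_const_nat subn0 /n truncn_le.
Qed.

End geometric.

(** * Measurability and size of the algorithm *)

Section process.
Context {R : realType} {d : nat} {dT : measure_display} {T : measurableType dT}.
Variables (rho1 rho2 delta : R) (gamma eps : nat -> R).
Hypothesis rho2P : 0 <= rho2 < 1.
Hypothesis delta_gt0 : 0 < delta.
Hypothesis eps_gt0 : forall n, (1 <= n)%N -> 0 < eps n.
Hypothesis eps_nondec : forall n m, (1 <= n <= m)%N -> eps n <= eps m.
Variables (theta0 : 'cV[R]_d) (s : T -> nat -> amsgrad_state (R := R) (d := d))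
  (g : T -> nat -> 'cV[R]_d).
Hypothesis s0 : forall w, s w 0%N = AmsgradState theta0 0 0 0.
Hypothesis sS : forall w n,
  s w n.+1 = amsgrad_step rho1 rho2 delta gamma eps n (s w n) (g w n.+1).

Lemma momentum_bounded_measurable :
  (forall n i, bounded_measurable (fun w => g w n.+1 i 0)) ->
  forall n i, bounded_measurable (fun w => momentum (s w n) i 0).
Proof.
move=> bg; elim=> [|n IH] i.
  under eq_fun do rewrite s0 mxE.
  exact: bm_cst.
under eq_fun do rewrite (momentumS _ _ _ _ _ _ _ (sS _)) !mxE.
by apply: bmD; apply: bmZ.
Qed.

(** The function is monotone once its argument is replaced by the positive part. *)
Lemma inv_sqrt_measurable (f : T -> R) : (forall w, 0 <= f w) ->
  measurable_fun [set: T] f ->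
  measurable_fun [set: T] (fun w => (Num.sqrt (delta + f w))^-1).
Proof.
move=> f0 mf; pose q (y : R) := (Num.sqrt (delta + Num.max 0 y))^-1.
have -> : (fun w => (Num.sqrt (delta + f w))^-1) = q \o f.
  by apply/funext => w; rewrite /q /= max_r.
apply: measurableT_comp => //; apply: nonincreasing_measurable => // y z yz.
have pos (t : R) : 0 < Num.sqrt (delta + Num.max 0 t).
  by rewrite sqrtr_gt0 ltr_pwDl // le_max lexx.
rewrite /q lef_pV2 ?posrE // ler_wsqrtr // lerD2l.
by rewrite ge_max !le_max lexx yz orbT.
Qed.

(** Stated over an arbitrary measurable space, so that it applies to the
    sigma-algebra of the past as well as to the whole one. *)
Lemma state_measurable n :
  (forall j i, (1 <= j <= n)%N -> measurable_fun [set: T] (fun w => g w j i 0)) ->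
  forall i,
  [/\ measurable_fun [set: T] (fun w => iterate (s w n) i 0),
      measurable_fun [set: T] (fun w => momentum (s w n) i 0),
      measurable_fun [set: T] (fun w => second_moment (s w n) i i),
      measurable_fun [set: T] (fun w => max_second_moment (s w n) i i) &
      measurable_fun [set: T] (fun w => precond delta (s w) n i)].
Proof.
elim: n => [|n IH] mg i.
  split; rewrite /precond; under eq_fun do rewrite s0 /=; exact: measurable_cst.
have [j k|IH1 IH2 IH3 IH4 _] := IH _ i.
  by move=> /andP[j1 jn]; apply: mg; rewrite j1 leqW.
have mgn : measurable_fun [set: T] (fun w => g w n.+1 i 0) by apply: mg; rewrite /= leqnn.
have m2 : measurable_fun [set: T] (fun w => momentum (s w n.+1) i 0).
  under eq_fun do rewrite (momentumS _ _ _ _ _ _ _ (sS _)) !mxE.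
  by apply: measurable_funD; apply: measurable_funM.
have m3 : measurable_fun [set: T] (fun w => second_moment (s w n.+1) i i).
  under eq_fun do rewrite (second_momentS _ _ _ _ _ _ _ (sS _)).
  apply: measurable_funD; apply: measurable_funM => //.
  by apply: measurable_minr => //; apply: measurable_funX.
have m4 : measurable_fun [set: T] (fun w => max_second_moment (s w n.+1) i i).
  under eq_fun do rewrite (max_second_momentS _ _ _ _ _ _ _ (sS _)).
  exact: measurable_maxr.
have m5 : measurable_fun [set: T] (fun w => precond delta (s w) n.+1 i).
  apply: inv_sqrt_measurable => // w.
  by have /andP[] := max_second_moment_bound _ _ _ _ _ rho2P eps_gt0 eps_nondec
    _ _ _ (s0 w) (sS w) n.+1 i.
split => //.
under eq_fun do rewrite (iterateS _ _ _ _ _ _ _ (sS _)) !mxE.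
apply: measurable_funB => //; apply: measurable_funM => //.
exact: measurable_funM.
Qed.

End process.

Section mlmc_estimator.
Context {R : realType} {d : nat} {X : Type}.
Variables (H : 'cV[R]_d -> X -> 'cV[R]_d) (G : R).
Hypothesis H_bounded : forall x, (sup_norm (H x) <= G%:E)%E.
Hypothesis G_ge0 : 0 <= G.

Lemma enorm_field_le theta x : enorm (H theta x) <= G.
Proof.
rewrite -lee_fin; apply: le_trans (H_bounded theta).
by apply: ereal_sup_ubound; exists x.
Qed.

Lemma enorm_path_average_le theta p (x : nat -> X) :
  enorm (path_average H theta p x) <= G.
Proof.
rewrite enormZ ger0_norm ?invr_ge0 ?ler0n //.
have : enorm (\sum_(1 <= i < p.+1) H theta (x i)) <= p%:R * G.
  apply: (le_trans (enorm_sum _ _ _)).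
  have -> : p%:R * G = \sum_(1 <= i < p.+1) G by rewrite sumr_const_nat subn1 mulr_natl.
  by apply: ler_sum => i _; exact: enorm_field_le.
case: p => [|p]; first by move=> _; rewrite invr0 mul0r.
by move=> h; rewrite ler_pdivrMl.
Qed.

Lemma enorm_mlmc_le theta T k (x : nat -> X) :
  enorm (mlmc H theta T k x) <= G + 2 * G * ((2 ^ k)%:R * ((2 ^ k)%:R <= T)%R%:R).
Proof.
apply: (le_trans (enormD _ _)); apply: lerD; first exact: enorm_field_le.
rewrite enormZ ger0_norm ?mulr_ge0 ?ler0n // mulrC ler_wpM2r ?mulr_ge0 ?ler0n //.
apply: (le_trans (enormB _ _)).
have -> : 2 * G = G + G by ring.
by apply: lerD; exact: enorm_path_average_le.
Qed.

Lemma enorm_mlmc_le_level theta T k (x : nat -> X) : 0 <= T ->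
  enorm (mlmc H theta T k x) <= G + 2 * G * T.
Proof.
move=> T0; apply: (le_trans (enorm_mlmc_le _ _ _ _)).
rewrite lerD2l ler_wpM2l ?mulr_ge0 //.
by case: (leP (2 ^ k)%:R T) => h /=; rewrite ?mulr1 ?mulr0.
Qed.

End mlmc_estimator.

(** * Mean of the pathwise inequality *)

Lemma lipschitz_coord_continuous {R : realType} {d : nat} (f : 'cV[R]_d -> 'cV[R]_d) (L : R) i :
  0 <= L -> (forall x y, enorm (f x - f y) <= L * enorm (x - y)) ->
  continuous (fun x => f x i 0).
Proof.
move=> L0 lip x A /nbhs_ballP[e0' /= e0'0 eA]; apply/nbhs_ballP.
pose e := e0' / 2; have e0 : 0 < e by rewrite divr_gt0.
pose r := e / (L * d%:R + 1).
have k0 : 0 < L * d%:R + 1 by rewrite ltr_wpDl // mulr_ge0.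
have r0 : 0 < r by rewrite divr_gt0.
exists r => // y [_ bxy]; apply: eA; rewrite /ball /=.
apply: (@le_lt_trans _ _ e); last by rewrite /e; lra.
have xy j : `|x j 0 - y j 0| <= r by exact/ltW/bxy.
have := coord_le_enorm (f x - f y) i; rewrite !mxE => /le_trans; apply.
apply: (le_trans (lip x y)).
have : enorm (x - y) <= d%:R * r.
  apply: (le_trans (enorm_le_l1 _)).
  have -> : d%:R * r = \sum_(j < d) r by rewrite sumr_const card_ord mulr_natl.
  by apply: ler_sum => j _; rewrite !mxE.
move=> /(ler_wpM2l L0) /le_trans; apply.
have -> : L * (d%:R * r) = e * (L * d%:R / (L * d%:R + 1)) by rewrite /r; field; rewrite gt_eqF.
by rewrite ler_piMr ?(ltW e0) // ler_pdivrMr // mul1r lerDl.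
Qed.

Section expectation.
Context {R : realType} {d : nat} {dO : measure_display} {Omega : measurableType dO}.
Variable P : probability Omega R.
Variables (rho1 rho2 delta : R) (gamma eps : nat -> R).
Hypothesis rho1P : 0 <= rho1 < 1.
Hypothesis rho2P : 0 <= rho2 < 1.
Hypothesis delta_gt0 : 0 < delta.
Hypothesis gamma_gt0 : forall n, (1 <= n)%N -> 0 < gamma n.
Hypothesis gamma_noninc : forall n m, (1 <= n <= m)%N -> gamma m <= gamma n.
Hypothesis eps_gt0 : forall n, (1 <= n)%N -> 0 < eps n.
Hypothesis eps_nondec : forall n m, (1 <= n <= m)%N -> eps n <= eps m.
Variables (theta0 : 'cV[R]_d) (s : Omega -> nat -> amsgrad_state (R := R) (d := d))
  (g : Omega -> nat -> 'cV[R]_d).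
Hypothesis s0 : forall w, s w 0%N = AmsgradState theta0 0 0 0.
Hypothesis sS : forall w n,
  s w n.+1 = amsgrad_step rho1 rho2 delta gamma eps n (s w n) (g w n.+1).
Variables (V : 'cV[R]_d -> R) (L G Vmin : R).
Hypothesis V_diff : forall x, differentiable (V : 'cV[R]_d -> R^o) x.
Hypothesis gradV_lip : forall x y, enorm (grad V x - grad V y) <= L * enorm (x - y).
Hypothesis gradV_bound : forall x, enorm (grad V x) <= G.
Hypothesis L_ge0 : 0 <= L.
Hypothesis V_ge : forall x, Vmin <= V x.
Variable S : nat -> set (set Omega).
Hypothesis F_sub : forall n, <<s S n >> `<=` @measurable _ Omega.
Hypothesis g_adapted : forall n j i, (1 <= j <= n)%N ->
  measurable_wrt <<s S n >> (fun w => g w j i 0).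
Hypothesis g_bounded : forall n, exists C, forall w, enorm (g w n.+1) <= C.
Variables M B beta : nat -> R.
Hypothesis M_ge0 : forall n, 0 <= M n.+1.
Hypothesis M_nondec : forall n m, (1 <= n <= m)%N -> M n <= M m.
Hypothesis g_moment : forall n, mean P (fun w => enorm (g w n.+1) ^+ 2) <= M n.+1.
Hypothesis g_bias : forall n, exists Y : Omega -> 'cV[R]_d,
  is_cond_exp_vec P <<s S n >> (fun w => g w n.+1) Y /\
  {ae P, forall w, enorm (Y w - grad V (iterate (s w n))) <= beta n}.

Let kap := (Num.sqrt delta)^-1.
Let kap_gt0 : 0 < kap. Proof. by rewrite invr_gt0 sqrtr_gt0. Qed.

Let bm_g n i : bounded_measurable (fun w => g w n.+1 i 0).
Proof.
split.
  move=> _ D mD; rewrite setTI; apply: (@F_sub n.+1).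
  by apply: g_adapted => //=; rewrite leqnn.
have [C gC] := g_bounded n; exists C => w.
exact: le_trans (coord_le_enorm _ _) (gC w).
Qed.

Let bm_sqr_enorm (f : Omega -> 'cV[R]_d) :
  (forall i, bounded_measurable (fun w => f w i 0)) ->
  bounded_measurable (fun w => enorm (f w) ^+ 2).
Proof.
move=> bf; under eq_fun do rewrite sqr_enorm.
by apply: bm_sum => i _; apply: bmX.
Qed.

Let state_mwrt n i :
  measurable_fun [set: g_sigma_algebraType (S n)] (fun w => iterate (s w n) i 0) /\
  measurable_fun [set: g_sigma_algebraType (S n)] (fun w => precond delta (s w) n i).
Proof.
have [|m1 _ _ _ m2] := state_measurable (T := g_sigma_algebraType (S n))
  _ _ _ _ _ rho2P delta_gt0 eps_gt0 eps_nondec _ _ _ s0 sS n _ i; last by split.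
move=> j k jn _ D mD; rewrite setTI; exact: g_adapted.
Qed.

Let grad_mwrt n i :
  measurable_fun [set: g_sigma_algebraType (S n)] (fun w => grad V (iterate (s w n)) i 0).
Proof.
apply: (continuous_measurable_coordinates (fun x => grad V x i 0)).
  exact: (lipschitz_coord_continuous _ L).
by move=> j; have [] := state_mwrt n j.
Qed.

Let mwrtT n (f : Omega -> R) :
  measurable_fun [set: g_sigma_algebraType (S n)] f -> measurable_fun [set: Omega] f.
Proof.
move=> mf _ D mD; rewrite setTI; apply: (@F_sub n).
by have := mf measurableT D mD; rewrite setTI.
Qed.

Let bm_grad n i : bounded_measurable (fun w => grad V (iterate (s w n)) i 0).
Proof.
split; first exact: (@mwrtT n).
by exists G => w; apply: le_trans (coord_le_enorm _ _) (gradV_bound _).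
Qed.

Let precondP w n i : 0 < precond delta (s w) n i <= kap.
Proof.
rewrite (precond_gt0 _ _ _ _ _ rho2P delta_gt0 eps_gt0 eps_nondec _ _ _ (s0 w) (sS w)).
exact: (precond_le _ _ _ _ _ rho2P delta_gt0 eps_gt0 eps_nondec _ _ _ (s0 w) (sS w)).
Qed.

Let bm_precond n i : bounded_measurable (fun w => precond delta (s w) n i).
Proof.
split; first by apply: (@mwrtT n); have [] := state_mwrt n i.
by exists kap => w; have /andP[h1 h2] := precondP w n i; rewrite ger0_norm // ltW.
Qed.

Let bm_gain n : bounded_measurable (fun w => gain delta gamma (s w) (g w) V n).
Proof.
apply: bmZ; apply: bm_sum => i _; apply: bmM => //; exact: bmM.
Qed.

Lemma bm_sqr_grad n : bounded_measurable (fun w => enorm (grad V (iterate (s w n))) ^+ 2).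
Proof. exact: bm_sqr_enorm. Qed.

Lemma sqr_grad_adapted n :
  measurable_wrt <<s S n >> (fun w => enorm (grad V (iterate (s w n))) ^+ 2).
Proof.
have m : measurable_fun [set: g_sigma_algebraType (S n)]
    (fun w => enorm (grad V (iterate (s w n))) ^+ 2).
  under eq_fun do rewrite sqr_enorm.
  by apply: measurable_sum => i; exact: measurable_funX.
by move=> D mD; have := m measurableT D mD; rewrite setTI.
Qed.

(** Given the past, the preconditioner of the previous step and the current
    gradient are constants, so the new sample may be replaced by its conditional
    mean, which is the gradient up to the bias. *)
Lemma mean_gain_ge n :
  gamma n.+1 * (eps_low rho2 delta eps n
      * mean P (fun w => enorm (grad V (iterate (s w n))) ^+ 2) - kap * G * beta n)
  <= mean P (fun w => gain delta gamma (s w) (g w) V n).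
Proof.
have [Y [Ycond Ybias]] := g_bias n.
have G0 : 0 <= G := le_trans (enorm_ge0 _) (gradV_bound theta0).
pose Z i w := grad V (iterate (s w n)) i 0 * precond delta (s w) n i.
have bZ i : bounded_measurable (Z i) by exact: bmM.
have mZ i : measurable_wrt <<s S n >> (Z i).
  move=> D mD.
  have mp := measurable_funM (grad_mwrt n i) (state_mwrt n i).2.
  have := mp measurableT D mD.
  by rewrite setTI.
have iY i : P.-integrable [set: Omega] (EFin \o (fun w => Y w i 0)).
  by have [] := Ycond i.
have ig i : P.-integrable [set: Omega] (EFin \o (fun w => g w n.+1 i 0)).
  exact: bm_integrable.
pose U i w := Y w i 0 - g w n.+1 i 0.
have iU i : P.-integrable [set: Omega] (EFin \o (U i)).
  exact: (integrableB measurableT (iY i) (ig i)).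
have zero i : mean P (fun w => Z i w * U i w) = 0.
  apply: (orthogonal_bounded P (S n)) => //; last by have [] := bZ i.
  move=> A FA; have mA : measurable A by exact: F_sub FA.
  rewrite /U RintegralB //; last 2 first.
  - by apply: integrableS (iY i).
  - by apply: integrableS (ig i).
  by apply/eqP; rewrite subr_eq0; apply/eqP; congr fine; have [_ _ _ ->] := Ycond i.
have iZf i (f : Omega -> R) : P.-integrable [set: Omega] (EFin \o f) ->
    P.-integrable [set: Omega] (EFin \o (fun w => Z i w * f w)).
  exact: integrable_bmM.
have E : mean P (fun w => gain delta gamma (s w) (g w) V n) =
    gamma n.+1 * mean P (fun w => \sum_(i < d) Z i w * Y w i 0).
  rewrite /gain meanZ; last first.
    by apply: bm_sum => i _; apply: bmM; [exact: bZ|exact: bm_g].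
  congr (_ * _).
  rewrite (mean_sum_integrable P _ _ (fun i w => Z i w * g w n.+1 i 0) _).2 => [|i];
    last exact: iZf.
  rewrite (mean_sum_integrable P _ _ (fun i w => Z i w * Y w i 0) _).2 => [|i]; last exact: iZf.
  apply: eq_bigr => i _.
  have := zero i.
  rewrite (_ : (fun w => Z i w * U i w) = fun w => Z i w * Y w i 0 - Z i w * g w n.+1 i 0).
    rewrite /mean RintegralB //; try exact: iZf.
    by move=> /eqP; rewrite subr_eq0 => /eqP ->.
  by apply/funext => w; rewrite mulrBr.
rewrite E ler_wpM2l ?(ltW (gamma_gt0 _ _)) //.
pose low w := eps_low rho2 delta eps n * enorm (grad V (iterate (s w n))) ^+ 2 - kap * G * beta n.
have b1 := bmZ (eps_low rho2 delta eps n) _ (bm_sqr_grad n).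
have blow : bounded_measurable low by exact: (bmB _ _ b1 (bm_cst _)).
have -> : eps_low rho2 delta eps n * mean P (fun w => enorm (grad V (iterate (s w n))) ^+ 2)
   - kap * G * beta n = mean P low.
  by rewrite (meanB P _ _ b1 (bm_cst _)) meanZ ?mean_cst //; exact: bm_sqr_grad.
have [iZY _] := mean_sum_integrable P _ (index_enum 'I_d) _ (fun i => iZf i _ (iY i)).
apply: mean_le_ae => //; first exact: bm_integrable.
apply: filterS Ybias => w; set D := grad V (iterate (s w n)) => Yw.
have -> : \sum_(i < d) Z i w * Y w i 0 =
    \sum_(i < d) precond delta (s w) n i * D i 0 ^+ 2
  + dot (\col_i (precond delta (s w) n i * D i 0)) (Y w - D).
  rewrite -big_split; apply: eq_bigr => i _ /=.
  by rewrite /Z -/D [(Y w - D) i 0]mxE [(- D) i 0]mxE [(\col_ _ _) i 0]mxE; ring.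
rewrite /low -/D; apply: lerD.
  rewrite sqr_enorm mulr_sumr; apply: ler_sum => i _; rewrite ler_wpM2r ?sqr_ge0 //.
  exact: (eps_low_le_precond _ _ _ _ _ rho2P delta_gt0 eps_gt0 eps_nondec _ _ _ (s0 w) (sS w)).
rewrite lerNl; apply: (le_trans (ler_norm _)); rewrite normrN.
apply: (le_trans (norm_dot_le_enorm _ _)).
apply: ler_pM; rewrite ?enorm_ge0 //.
rewrite -ler_sqr ?nnegrE ?mulr_ge0 ?enorm_ge0 ?(ltW kap_gt0) //.
apply: (@le_trans _ _ (kap ^+ 2 * enorm D ^+ 2)).
  rewrite !sqr_enorm mulr_sumr; apply: ler_sum => i _.
  rewrite mxE exprMn ler_wpM2r ?sqr_ge0 //.
  have /andP[h1 h2] := precondP w n i.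
  by rewrite ler_sqr ?nnegrE ?(ltW h1) ?(ltW kap_gt0).
rewrite exprMn ler_wpM2l ?sqr_ge0 // ler_sqr ?nnegrE ?enorm_ge0 //.
exact: gradV_bound.
Qed.

Let bm_momentum n i : bounded_measurable (fun w => momentum (s w n) i 0).
Proof. exact: (momentum_bounded_measurable _ _ _ _ _ _ _ _ s0 sS bm_g). Qed.

Let bm_tail n i : bounded_measurable (fun w => tail rho1 (s w) (g w) n i 0).
Proof.
under eq_fun do rewrite !mxE.
by apply: bmB => //; apply: bmZ; exact: bm_g.
Qed.

(** The weights 1 - rho1^n satisfy rho1 (1 - rho1^n) + (1 - rho1) = 1 - rho1^(n+1),
    which is the recursion that convexity gives for the second moments. *)
Let moment_step (x : Omega -> 'cV[R]_d) (y : Omega -> 'cV[R]_d) n (C : R) :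
  (forall i, bounded_measurable (fun w => x w i 0)) ->
  (forall w, y w = rho1 *: x w + (1 - rho1) *: g w n.+1) ->
  mean P (fun w => enorm (x w) ^+ 2) <= (1 - rho1 ^+ n) * M n.+1 ->
  mean P (fun w => enorm (y w) ^+ 2) <= (1 - rho1 ^+ n.+1) * M n.+1.
Proof.
move=> bx yE xM; have /andP[r0 r1] := rho1P.
have bx2 : bounded_measurable (fun w => enorm (x w) ^+ 2) by exact: bm_sqr_enorm.
have bg2 : bounded_measurable (fun w => enorm (g w n.+1) ^+ 2).
  by apply: bm_sqr_enorm => i; exact: bm_g.
have bxr := bmZ rho1 _ bx2; have bgr := bmZ (1 - rho1) _ bg2.
have : mean P (fun w => enorm (y w) ^+ 2) <=
    mean P (fun w => rho1 * enorm (x w) ^+ 2 + (1 - rho1) * enorm (g w n.+1) ^+ 2).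
  apply: mean_le; [|exact: bmD|].
    apply: bm_sqr_enorm => i; under eq_fun do rewrite yE !mxE.
    by apply: bmD; apply: bmZ => //; exact: bm_g.
  move=> w; rewrite !sqr_enorm !mulr_sumr -big_split; apply: ler_sum => i _ /=.
  by rewrite yE !mxE; exact: convex_sqr.
rewrite (meanD P _ _ bxr bgr) !meanZ // => /le_trans; apply.
have h1 := ler_wpM2l r0 xM.
have r1' : 0 <= 1 - rho1 by rewrite subr_ge0 ltW.
have h2 := ler_wpM2l r1' (g_moment n).
rewrite exprS; lra.
Qed.

Lemma mean_momentum n :
  mean P (fun w => enorm (momentum (s w n)) ^+ 2) <= (1 - rho1 ^+ n) * M n.
Proof.
have /andP[r0 r1] := rho1P.
elim: n => [|n IH].
  under eq_fun do rewrite s0 /= enorm0 expr0n /=.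
  by rewrite mean_cst expr0 subrr mul0r.
apply: (moment_step (fun w => momentum (s w n))) => //.
  by move=> w; exact: (momentumS _ _ _ _ _ _ _ (sS w)).
apply: (le_trans IH); case: n {IH} => [|n]; first by rewrite expr0 subrr !mul0r.
by rewrite ler_wpM2l ?M_nondec ?leqnSn // subr_ge0 exprn_ile1 // ltW.
Qed.

Lemma mean_tail n :
  mean P (fun w => enorm (tail rho1 (s w) (g w) n.+1) ^+ 2) <= (1 - rho1 ^+ n.+1) * M n.+1.
Proof.
have /andP[r0 r1] := rho1P.
elim: n => [|n IH].
  under eq_fun do rewrite (tail1 _ _ _ _ _ _ _ _ (s0 _) (sS _)) enorm0 expr0n /=.
  by rewrite mean_cst mulr_ge0 // subr_ge0 expr1 ltW.
apply: (moment_step (fun w => tail rho1 (s w) (g w) n.+1)) => //.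
  by move=> w; exact: (tailS _ _ _ _ _ _ _ (sS w)).
apply: (le_trans IH); rewrite ler_wpM2l ?M_nondec ?leqnSn //.
by rewrite subr_ge0 exprn_ile1 // ltW.
Qed.

Let bm_scaled n (x : Omega -> 'cV[R]_d) : (forall i, bounded_measurable (fun w => x w i 0)) ->
  forall i, bounded_measurable
    (fun w => (\col_i (gamma n * precond delta (s w) n i * x w i 0) : 'cV[R]_d) i 0).
Proof.
move=> bx i; under eq_fun do rewrite mxE.
by apply: bmM => //; apply: bmZ.
Qed.

Let mean_scaled n (x : Omega -> 'cV[R]_d) (q : R) :
  (forall i, bounded_measurable (fun w => x w i 0)) ->
  mean P (fun w => enorm (x w) ^+ 2) <= q ->
  mean P (fun w => enorm (\col_i (gamma n * precond delta (s w) n i * x w i 0)) ^+ 2)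
  <= kap ^+ 2 * (gamma n ^+ 2 * q).
Proof.
move=> bx xq.
have bx2 : bounded_measurable (fun w => enorm (x w) ^+ 2) by exact: bm_sqr_enorm.
apply: (@le_trans _ _ (mean P (fun w => kap ^+ 2 * gamma n ^+ 2 * enorm (x w) ^+ 2))).
  apply: mean_le; [by apply: bm_sqr_enorm; exact: bm_scaled|exact: bmZ|].
  move=> w; rewrite !sqr_enorm mulr_sumr; apply: ler_sum => i _.
  rewrite mxE exprMn exprMn ler_wpM2r ?sqr_ge0 // mulrC ler_wpM2r ?sqr_ge0 //.
  have /andP[h1 h2] := precondP w n i.
  by rewrite ler_sqr ?nnegrE ?(ltW h1) ?(ltW kap_gt0).
by rewrite meanZ // -mulrA ler_wpM2l ?sqr_ge0 // ler_wpM2l ?sqr_ge0.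
Qed.

Variable B1 : R.
Hypothesis g1_mean : mean P (fun w => \sum_(i < d) `|g w 1%N i 0|) <= B1.
Let c := rho1 / (1 - rho1).

(** The mean of [gain_sum], with the gains bounded below by [mean_gain_ge] and the
    squares bounded above by the second moments. *)
Lemma weighted_gradient_sum N :
  \sum_(1 <= n < N.+1) gamma n.+1 * (eps_low rho2 delta eps n
      * mean P (fun w => enorm (grad V (iterate (s w n))) ^+ 2) - kap * G * beta n)
  <= V theta0 - Vmin
    + d%:R * (G * kap ^+ 2 / 2 / (1 - rho1))
    + G * kap * gamma 1%N * B1
    + L / 2 * \sum_(1 <= n < N.+2) kap ^+ 2 * (gamma n ^+ 2 * ((1 - rho1 ^+ n) * M n))
    + c * (L / 2) * \sum_(1 <= n < N.+1) 2 * (kap ^+ 2 * (gamma n ^+ 2 * ((1 - rho1 ^+ n) * M n)))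
    + d%:R * (rho1 * G / (2 * (1 - rho1)) * kap ^+ 2)
      * \sum_(1 <= n < N.+1) (1 - gamma n.+1 ^+ 2 / gamma n ^+ 2)
    + G * (1 + rho1) / 2 * \sum_(1 <= n < N.+1) gamma n.+1 ^+ 2 * M n.+1.
Proof.
have /andP[r0 r1] := rho1P.
have G0 : 0 <= G := le_trans (enorm_ge0 _) (gradV_bound theta0).
have c0 : 0 <= c by rewrite divr_ge0 // subr_ge0 ltW.
have bu n : bounded_measurable (fun w => enorm (update delta gamma (s w) n) ^+ 2).
  by apply: bm_sqr_enorm; apply: bm_scaled; exact: bm_momentum.
have bt n : bounded_measurable (fun w => enorm (tail_update rho1 delta gamma (s w) (g w) n) ^+ 2).
  by apply: bm_sqr_enorm; apply: bm_scaled; exact: bm_tail.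
have but n : bounded_measurable (fun w => enorm (update delta gamma (s w) n) ^+ 2
    + enorm (tail_update rho1 delta gamma (s w) (g w) n) ^+ 2) by exact: bmD.
have bg2 n : bounded_measurable (fun w => gamma n.+1 ^+ 2 * enorm (g w n.+1) ^+ 2).
  by apply: bmZ; apply: bm_sqr_enorm => i; exact: bm_g.
have bg1 : bounded_measurable (fun w => \sum_(i < d) `|g w 1%N i 0|).
  by apply: bm_sum => i _; apply: bm_norm; exact: bm_g.
pose K0 := V theta0 - Vmin + d%:R * (G * kap ^+ 2 / 2 / (1 - rho1)).
pose K1 := d%:R * (rho1 * G / (2 * (1 - rho1)) * kap ^+ 2)
      * \sum_(1 <= n < N.+1) (1 - gamma n.+1 ^+ 2 / gamma n ^+ 2).
pose f1 w := G * kap * gamma 1%N * \sum_(i < d) `|g w 1%N i 0|.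
pose f2 w := L / 2 * \sum_(1 <= n < N.+2) enorm (update delta gamma (s w) n) ^+ 2.
pose f3 w := c * (L / 2) * \sum_(1 <= n < N.+1) (enorm (update delta gamma (s w) n) ^+ 2
    + enorm (tail_update rho1 delta gamma (s w) (g w) n) ^+ 2).
pose f4 w := G * (1 + rho1) / 2 * \sum_(1 <= n < N.+1) gamma n.+1 ^+ 2 * enorm (g w n.+1) ^+ 2.
have b1 : bounded_measurable f1 by exact: bmZ.
have b2 : bounded_measurable f2 by apply: bmZ; exact: bm_sum.
have b3 : bounded_measurable f3 by apply: bmZ; exact: bm_sum.
have b4 : bounded_measurable f4 by apply: bmZ; exact: bm_sum.
have bgs : bounded_measurable (fun w => \sum_(1 <= n < N.+1) gain delta gamma (s w) (g w) V n).
  exact: bm_sum.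
apply: (@le_trans _ _ (mean P (fun w => \sum_(1 <= n < N.+1) gain delta gamma (s w) (g w) V n))).
  by rewrite mean_sum //; apply: ler_sum => n _; exact: mean_gain_ge.
have b12 := bmD _ _ b1 b2; have b123 := bmD _ _ b12 b3; have b1234 := bmD _ _ b123 b4.
apply: (@le_trans _ _ (mean P (fun w => K0 + K1 + (f1 w + f2 w + f3 w + f4 w)))).
  apply: mean_le => //; first by apply: bmD => //; exact: bm_cst.
  move=> w; have := gain_sum _ _ _ _ _ rho1P rho2P delta_gt0 gamma_gt0 gamma_noninc
    eps_gt0 eps_nondec _ _ _ (s0 w) (sS w) V L G Vmin V_diff gradV_lip gradV_bound L_ge0 V_ge N.
  rewrite /K0 /K1 /f1 /f2 /f3 /f4 -/kap -/c; lra.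
rewrite (meanD P _ _ (bm_cst _) b1234) mean_cst.
rewrite (meanD P _ _ b123 b4) (meanD P _ _ b12 b3) (meanD P _ _ b1 b2).
rewrite !meanZ //; try exact: bm_sum.
move: g1_mean; set m1 := mean P (fun w => \sum_(i < d) `|g w 1%N i 0|) => m1B.
rewrite !mean_sum //.
have h1 : G * kap * gamma 1%N * m1
    <= G * kap * gamma 1%N * B1.
  by rewrite ler_wpM2l // !mulr_ge0 ?(ltW kap_gt0) ?(ltW (gamma_gt0 _ _)).
have hu n : mean P (fun w => enorm (update delta gamma (s w) n) ^+ 2) <=
    kap ^+ 2 * (gamma n ^+ 2 * ((1 - rho1 ^+ n) * M n)).
  by apply: mean_scaled; [exact: bm_momentum|exact: mean_momentum].
have h2 : L / 2 * \sum_(1 <= n < N.+2) mean P (fun w => enorm (update delta gamma (s w) n) ^+ 2)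
   <= L / 2 * \sum_(1 <= n < N.+2) kap ^+ 2 * (gamma n ^+ 2 * ((1 - rho1 ^+ n) * M n)).
  by rewrite ler_wpM2l ?divr_ge0 //; apply: ler_sum => n _; exact: hu.
have h3 : c * (L / 2) * \sum_(1 <= n < N.+1)
      mean P (fun w => enorm (update delta gamma (s w) n) ^+ 2
      + enorm (tail_update rho1 delta gamma (s w) (g w) n) ^+ 2)
   <= c * (L / 2) * \sum_(1 <= n < N.+1) 2 * (kap ^+ 2 * (gamma n ^+ 2 * ((1 - rho1 ^+ n) * M n))).
  apply: ler_wpM2l; first by apply: mulr_ge0 => //; exact: divr_ge0.
  rewrite big_nat [leRHS]big_nat; apply: ler_sum => -[//|n] _.
  rewrite meanD // mulr_natl mulr2n; apply: lerD; first exact: hu.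
  by apply: mean_scaled; [exact: bm_tail|exact: mean_tail].
have h4 : G * (1 + rho1) / 2 * \sum_(1 <= n < N.+1)
      mean P (fun w => gamma n.+1 ^+ 2 * enorm (g w n.+1) ^+ 2)
   <= G * (1 + rho1) / 2 * \sum_(1 <= n < N.+1) gamma n.+1 ^+ 2 * M n.+1.
  rewrite ler_wpM2l ?divr_ge0 ?mulr_ge0 ?addr_ge0 //; apply: ler_sum => n _.
  rewrite meanZ; last by apply: bm_sqr_enorm => i; exact: bm_g.
  by rewrite ler_wpM2l ?sqr_ge0.
rewrite /K0 /K1; lra.
Qed.

End expectation.

(** * Random index and arithmetic of the constants *)

Section random_index.
Context {R : realType} {dO : measure_display} {Omega : measurableType dO}.
Variable P : probability Omega R.

Lemma mean_indep_level (r : {RV P >-> nat}) (S : set (set Omega)) (f : Omega -> R) n :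
  <<s S >> `<=` @measurable _ Omega ->
  independent_classes P (g_sigma_algebra_preimage r) <<s S >> ->
  bounded_measurable f -> measurable_wrt <<s S >> f ->
  mean P (fun w => \1_(r @^-1` [set n]) w * f w) = fine (P (r @^-1` [set n])) * mean P f.
Proof.
move=> sub ind bf mf; set A := r @^-1` [set n]; set p := fine (P A).
have mA : measurable A by exact: measurable_level.
have bA : bounded_measurable (\1_A : Omega -> R) := bm_indic A mA.
have bAp := bmB _ _ bA (bm_cst p).
have : mean P (fun w => f w * (\1_A w - p)) = 0.
  apply: (orthogonal_bounded P S) => //; [exact: bm_integrable| |by have [] := bf].
  move=> C SC; have mC : measurable C by exact: sub.
  rewrite RintegralB //; last 2 first.
  - by apply: integrableS (bm_integrable P _ bA).
  - by apply: integrableS (bm_integrable P _ (bm_cst p)).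
  have PAC : fine (P (A `&` C)) = p * fine (P C).
    rewrite (ind A C) //; last by exists [set n] => //; exact: setTI.
    by rewrite fineM //; exact: fin_num_measure.
  rewrite Rintegral_cst // /Rintegral integral_indic //.
  by apply/eqP; rewrite subr_eq0; apply/eqP; exact: PAC.
have -> : (fun w => f w * (\1_A w - p)) = (fun w => \1_A w * f w - p * f w).
  by apply/funext => w; ring.
rewrite (meanB P _ _ (bmM _ _ bA bf) (bmZ p _ bf)) meanZ //.
by move=> /eqP; rewrite subr_eq0 => /eqP.
Qed.

(** The levels 0..N of the index carry full mass, so the mean splits over them
    and independence factors each part. *)
Lemma mean_random_index (r : {RV P >-> nat}) (S : set (set Omega))
    (f : nat -> Omega -> R) (C : R) (N : nat) :
  <<s S >> `<=` @measurable _ Omega ->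
  independent_classes P (g_sigma_algebra_preimage r) <<s S >> ->
  (forall n, measurable_wrt <<s S >> (f n)) -> (forall n w, 0 <= f n w <= C) ->
  \sum_(0 <= n < N.+1) fine (P (r @^-1` [set n])) = 1 ->
  bounded_measurable (fun w => f (r w) w) /\
  mean P (fun w => f (r w) w) <=
    \sum_(0 <= n < N.+1) fine (P (r @^-1` [set n])) * mean P (f n).
Proof.
move=> sub ind mf fC sum1.
have bf n : bounded_measurable (f n).
  split; first by move=> _ D mD; rewrite setTI; apply: sub; exact: mf.
  by exists C => w; have /andP[h1 h2] := fC n w; rewrite ger0_norm.
have bind n : bounded_measurable (\1_(r @^-1` [set n]) : Omega -> R).
  by apply: bm_indic; exact: measurable_level.
have bfr : bounded_measurable (fun w => f (r w) w).
  split; last by exists C => w; have /andP[h1 h2] := fC (r w) w; rewrite ger0_norm.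
  move=> _ D mD; rewrite setTI.
  rewrite (_ : _ @^-1` D = \bigcup_n (r @^-1` [set n] `&` f n @^-1` D)).
    apply: bigcupT_measurable => n; apply: measurableI; first exact: measurable_level.
    by apply: sub; exact: mf.
  by apply/seteqP; split => [w Dw|w [n _ [/= -> //]]]; exists (r w).
split => //.
pose lev n (w : Omega) : R := \1_(r @^-1` [set n]) w.
have bi : bounded_measurable (fun w => \sum_(0 <= n < N.+1) lev n w).
  by apply: bm_sum => n _; exact: bind.
have bif : bounded_measurable (fun w => \sum_(0 <= n < N.+1) lev n w * f n w).
  by apply: bm_sum => n _; apply: bmM; [exact: bind|exact: bf].
have brest := bmZ C _ (bmB _ _ (bm_cst 1) bi).
apply: (@le_trans _ _ (mean P (fun w => \sum_(0 <= n < N.+1) lev n w * f n w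
    + C * (1 - \sum_(0 <= n < N.+1) lev n w)))).
  apply: mean_le => //; first exact: bmD.
  move=> w; rewrite /lev.
  have [rN|Nr] := ltnP (r w) N.+1.
    rewrite !(bigD1_seq (r w)) ?iota_uniq ?mem_index_iota //= !level_indicE eqxx.
    rewrite !big1; last 2 first.
    - by move=> n /negPf nr; rewrite level_indicE eq_sym nr.
    - by move=> n /negPf nr; rewrite level_indicE eq_sym nr mul0r.
    by rewrite mul1r !addr0 subrr mulr0 addr0.
  rewrite !big_nat !big1; last 2 first.
  - move=> n /andP[_ nN]; rewrite level_indicE; case: eqP => // rn.
    by rewrite -rn ltnNge Nr in nN.
  - move=> n /andP[_ nN]; rewrite level_indicE; case: eqP => [rn|_]; last by rewrite mul0r.
    by rewrite -rn ltnNge Nr in nN.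
  by rewrite add0r subr0 mulr1; have /andP[] := fC (r w) w.
rewrite (meanD P _ _ bif brest) meanZ; last by apply: bmB => //; exact: bm_cst.
rewrite (meanB P _ _ (bm_cst 1) bi) mean_cst.
rewrite (mean_sum P _ _ (fun n w => lev n w * f n w)) => [|n]; last first.
  exact: (bmM _ _ (bind n) (bf n)).
rewrite (mean_sum P _ _ lev) => [|n]; last exact: bind.
have -> : \sum_(0 <= n < N.+1) mean P (lev n) = 1.
  rewrite -sum1; apply: eq_bigr => n _.
  by rewrite /lev mean_indic //; exact: measurable_level.
rewrite subrr mulr0 addr0; apply: ler_sum => n _.
by rewrite (mean_indep_level r S).
Qed.

End random_index.

(** Here [p n] stands for gamma_n^2 M_n. Since rho / (1 - rho) =
    rho + rho^2 / (1 - rho), moving the last sum to the left leaves, for n <= N,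
    the coefficient k = L / 2 + rho L - rho^2 L^2 / (2 (1 - rho)) on
    (1 - rho^n) [p n]. As (1 - rho^n) / (1 - rho) >= 1, the inequality
    rho L <= 1 / 2 + rho^2 L^2 / 2 gives k (1 - rho^n) <= 1 / 2 + L. The index
    n = 1 is apart and paid by [L * p 1], as the sum of the [p n.+1] starts
    at [p 2]. *)
Lemma squares_budget {R : realType} (rho L : R) (p : nat -> R) (N : nat) :
  0 <= rho < 1 -> 0 <= L -> (forall n, 0 <= p n.+1) ->
  L / 2 * \sum_(1 <= n < N.+2) (1 - rho ^+ n) * p n
  + rho / (1 - rho) * L * \sum_(1 <= n < N.+1) (1 - rho ^+ n) * p n <=
  L * p 1%N + (1 / 2 + L) * \sum_(1 <= n < N.+1) p n.+1
  + (rho ^+ 2 * L ^+ 2 + 2 * rho ^+ 2 * L) / (2 * (1 - rho))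
    * \sum_(1 <= n < N.+1) (1 - rho ^+ n) * p n.
Proof.
move=> /andP[r0 r1] L0 p0.
have r1' : 0 < 1 - rho by rewrite subr_gt0.
have qP n : 1 - rho <= 1 - rho ^+ n.+1 <= 1.
  have h1 : 0 <= rho ^+ n.+1 by exact: exprn_ge0.
  have h2 : rho ^+ n.+1 <= rho by rewrite exprS ler_piMr // exprn_ile1 // ltW.
  by apply/andP; split; lra.
pose k := L / 2 + rho * L - rho ^+ 2 * L ^+ 2 / (2 * (1 - rho)).
have kE : L / 2 + rho / (1 - rho) * L = k
   + (rho ^+ 2 * L ^+ 2 + 2 * rho ^+ 2 * L) / (2 * (1 - rho)).
  by rewrite /k; field; rewrite gt_eqF.
have main n : \sum_(1 <= j < n.+2) k * ((1 - rho ^+ j) * p j) <=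
   L * p 1%N + (1 / 2 + L) * \sum_(1 <= j < n.+1) p j.+1.
  elim: n => [|n IH].
    rewrite big_nat1 big_geq // mulr0 addr0 expr1 mulrA ler_wpM2r //.
    have -> : k * (1 - rho) = (L / 2 + rho * L) * (1 - rho) - rho ^+ 2 * L ^+ 2 / 2.
      by rewrite /k; field; rewrite gt_eqF.
    have := sqr_ge0 (rho * L); rewrite exprMn => h.
    have : 0 <= L * rho ^+ 2 by rewrite mulr_ge0 ?sqr_ge0.
    have : 0 <= L * (1 - rho) by rewrite mulr_ge0 ?(ltW r1').
    rewrite expr2 in h *; rewrite expr2; lra.
  rewrite big_nat_recr //= [\sum_(1 <= j < n.+2) p j.+1]big_nat_recr //= mulrDr addrA.
  apply: lerD => //; rewrite mulrA ler_wpM2r //.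
  have /andP[q1 q2] := qP n.+1; set q := 1 - rho ^+ n.+2 in q1 q2 *.
  have e0 : 0 <= rho ^+ 2 * L ^+ 2 / (2 * (1 - rho)).
    by rewrite divr_ge0 ?mulr_ge0 ?sqr_ge0 // ltW.
  have h1 := ler_wpM2l e0 q1.
  have E : rho ^+ 2 * L ^+ 2 / (2 * (1 - rho)) * (1 - rho) = (rho * L) ^+ 2 / 2.
    by field; rewrite gt_eqF.
  have c0 : 0 <= L / 2 + rho * L by rewrite addr_ge0 ?divr_ge0 ?mulr_ge0.
  have h2 := ler_wpM2l c0 q2.
  have h3 := sqr_ge0 (rho * L - 1).
  rewrite E in h1; rewrite sqrrB1 in h3; rewrite /k; lra.
set S1 := \sum_(1 <= n < N.+1) (1 - rho ^+ n) * p n.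
have S1k : \sum_(1 <= n < N.+1) k * ((1 - rho ^+ n) * p n) = k * S1 by rewrite mulr_sumr.
rewrite [\sum_(1 <= n < N.+2) _]big_nat_recr //= -/S1.
have last : L / 2 * ((1 - rho ^+ N.+1) * p N.+1) <= L / 2 * p N.+1.
  by rewrite ler_wpM2l ?divr_ge0 // ler_piMl //; have /andP[] := qP N.
suff : k * S1 + L / 2 * p N.+1 <= L * p 1%N + (1 / 2 + L) * \sum_(1 <= n < N.+1) p n.+1.
  have : (L / 2 + rho / (1 - rho) * L) * S1 = (k
   + (rho ^+ 2 * L ^+ 2 + 2 * rho ^+ 2 * L) / (2 * (1 - rho))) * S1 by rewrite kE.
  rewrite !mulrDl; lra.
rewrite -S1k; case: N {S1 S1k last} => [|N].
  by rewrite !big_geq // mulr0 addr0 add0r ler_wpM2r //; lra.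
rewrite [\sum_(1 <= n < N.+2) p _]big_nat_recr //=.
have := main N; have := p0 N.+1 => h; have := mulr_ge0 L0 h; lra.
Qed.

(** * The convergence bound *)

(** Pair the mean with itself: |v|^2 is the mean of <v, H>, at most |v| G. *)
Lemma enorm_mean_field_le {R : realType} {dX : measure_display} {X : measurableType dX}
    {d : nat} (H : 'cV[R]_d -> X -> 'cV[R]_d) (mu : 'cV[R]_d -> probability X R) (G : R) theta :
  (forall i, measurable_fun [set: X] (fun x => H theta x i 0)) ->
  (forall x, enorm (H theta x) <= G) ->
  0 <= G -> enorm (mean_field H mu theta) <= G.
Proof.
move=> mH HG G0; set v := mean_field H mu theta.
have bH i : bounded_measurable (fun x => H theta x i 0).
  by split => //; exists G => x; exact: le_trans (coord_le_enorm _ _) (HG x).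
have vv : enorm v ^+ 2 = mean (mu theta) (fun x => dot v (H theta x)).
  rewrite -dotxx mean_sum => [|i]; last by apply: bmZ; exact: bH.
  apply: eq_bigr => i _; rewrite meanZ //; congr (_ * _).
  by rewrite {1}/v mxE.
have : enorm v ^+ 2 <= enorm v * G.
  rewrite vv -(mean_cst (mu theta) (enorm v * G)); apply: mean_le.
  - by apply: bm_sum => i _; apply: bmZ; exact: bH.
  - exact: bm_cst.
  - move=> x; apply: (le_trans (dot_le_enorm _ _)).
    by rewrite ler_wpM2l ?enorm_ge0.
have := enorm_ge0 v; rewrite le_eqVlt => /orP[/eqP <- //|v0].
by rewrite expr2 ler_pM2l.
Qed.

Section sampling_measurability.
Context {R : realType} {dO dX : measure_display}.
Context {Omega : measurableType dO} {X : measurableType dX}.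
Variable P : probability Omega R.
Variables (K : nat -> {RV P >-> nat}) (Xs : nat -> nat -> {RV P >-> X}).

Lemma history_measurable D : <<s history K Xs D >> `<=` @measurable _ Omega.
Proof.
apply: smallest_sub; first exact: sigma_algebra_measurable.
move=> A [j _ [[B mB <-]|[i _ [B mB <-]]]]; rewrite setTI.
  by rewrite -[X in measurable X]setTI; exact: measurable_funPT.
by rewrite -[X in measurable X]setTI; exact: measurable_funPT.
Qed.

Lemma history_mono D D' : D `<=` D' -> <<s history K Xs D >> `<=` <<s history K Xs D' >>.
Proof.
move=> DD'; apply: sub_sigma_algebra2.
by move=> A [j Dj hA]; exists j => //; exact: DD'.
Qed.

End sampling_measurability.

Theorem theorem3p5
  (R : realType) (d : nat) (d_gt0 : (0 < d)%N)
  (dX : measure_display) (X : measurableType dX)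
  (V : 'cV[R]_d -> R) (theta_star : 'cV[R]_d)
  (theta_starP : forall theta, V theta_star <= V theta)
  (H : 'cV[R]_d -> X -> 'cV[R]_d)
  (H_meas : forall theta i, measurable_fun [set: X] (fun x => H theta x i 0))
  (Pk : 'cV[R]_d -> R.-pker X ~> X) (Pinv : 'cV[R]_d -> probability X R)
  (PinvP : forall theta, invariant_law (Pk theta) (Pinv theta))
  (h_grad : forall theta, mean_field H Pinv theta = grad V theta)
  (rho1 rho2 delta : R) (gamma T eps : nat -> R)
  (rho1P : 0 <= rho1 < 1) (rho2P : 0 <= rho2 < 1) (delta_gt0 : 0 < delta)
  (gamma_gt0 : forall n, (1 <= n)%N -> 0 < gamma n)
  (gamma_noninc : forall n m, (1 <= n <= m)%N -> gamma m <= gamma n)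
  (T_gt0 : forall n, (1 <= n)%N -> 0 < T n)
  (T_nondec : forall n m, (1 <= n <= m)%N -> T n <= T m)
  (eps_gt0 : forall n, (1 <= n)%N -> 0 < eps n)
  (eps_nondec : forall n m, (1 <= n <= m)%N -> eps n <= eps m)
  (dO : measure_display) (Omega : measurableType dO) (P : probability Omega R)
  (K : nat -> {RV P >-> nat}) (Xs : nat -> nat -> {RV P >-> X})
  (theta0 : 'cV[R]_d) :
  let theta (n : nat) (w : Omega) : 'cV[R]_d :=
    iterate (amsgrad H rho1 rho2 delta gamma T eps theta0
               (fun j => K j w) (fun j i => Xs j i w) n) in
  let Hhat (n : nat) (w : Omega) : 'cV[R]_d :=
    mlmc_at H rho1 rho2 delta gamma T eps theta0
      (fun j => K j w) (fun j i => Xs j i w) n in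
  let F := filtration K Xs in
  forall
  (K_geom : forall n k, (1 <= n)%N -> (1 <= k)%N ->
     P (K n @^-1` [set k]) = ((2 ^+ k)^-1)%:E)
  (K_indep : mutually_independent K)
  (K_indep_chain : forall n, independent_classes P
     (g_sigma_algebra_preimage (K n.+1)) (full_chain_filtration K Xs n))
  (X_markov : forall n, conditionally_markov K Xs n Pk (theta n))
  (Hhat_adapted : forall n i, (1 <= n)%N ->
     measurable_wrt (F n) (fun w => Hhat n w i 0))
  (L : R)
  (V_diff : forall x, differentiable (V : 'cV[R]_d -> R^o) x)
  (gradV_lip : forall x y,
     enorm (grad V x - grad V y) <= L * enorm (x - y))
  (G : R) (G_gt0 : 0 < G)
  (H_bounded : forall x, (sup_norm (H x) <= G%:E)%E)
  (c1 c2 : R) (c2_gt0 : 0 < c2)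
  (Hhat_bias : forall n, exists Y : Omega -> 'cV[R]_d,
     is_cond_exp_vec P (F n) (Hhat n.+1) Y /\
     {ae P, forall w,
        enorm (Y w - mean_field H Pinv (theta n w)) <= c1 * G / T n.+1})
  (Hhat_second_moment : forall n,
     ('E_P[(fun w => enorm (Hhat n.+1 w) ^+ 2)%R]
        <= (c2 * G ^+ 2 * ln (T n.+1))%:E)%E),
  let epsl := eps_low rho2 delta eps in
  let varpiN := varpi rho2 delta gamma eps in
  let b0 :=
    d%:R * G / (2 * delta * (1 - rho1))
    + gamma 1%N * Num.sqrt (d%:R / delta) * (1 + 2 * (ln (T 1%N) / ln 2))
      * G ^+ 2
    + c2 * (L / delta) * G ^+ 2 * gamma 1%N ^+ 2 * ln (T 1%N)
    + epsl 0%N * gamma 1%N * G ^+ 2 in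
  let b1 := c1 * (G ^+ 2 / Num.sqrt delta) in
  let b2 := c2 / (2 * delta) * (1 + 2 * L + 2 * delta * G) * G ^+ 2 in
  let b3 :=
    c2 * G ^+ 2 / (2 * delta * (1 - rho1))
    * (rho1 ^+ 2 * L ^+ 2 + 2 * rho1 ^+ 2 * L
       + rho1 * delta * (1 - rho1) * G) in
  let b4 := d%:R * rho1 * G / (2 * delta * (1 - rho1)) in
  forall (N : nat) (N_ge1 : (1 <= N)%N)
  (r : {RV P >-> nat})
  (r_law : forall n, (n <= N)%N ->
     P (r @^-1` [set n]) = (gamma n.+1 * epsl n / varpiN N)%:E)
  (r_indep : independent_classes P
     (g_sigma_algebra_preimage r) (algorithm_sigma K Xs)),
  ('E_P[(fun w => enorm (grad V (theta (r w) w)) ^+ 2)%R]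
   <= ((varpiN N)^-1)%:E *
      ('E_P[(fun w => V (theta 0%N w))%R]
       + (- V theta_star + b0
          + b1 * \sum_(1 <= n < N.+1) gamma n.+1 / T n.+1
          + b2 * \sum_(1 <= n < N.+1) gamma n.+1 ^+ 2 * ln (T n.+1)
          + b3 * \sum_(1 <= n < N.+1)
                   (1 - rho1 ^+ n) * gamma n ^+ 2 * ln (T n)
          + b4 * \sum_(1 <= n < N.+1)
                   (1 - gamma n.+1 ^+ 2 / gamma n ^+ 2))%:E))%E.
Proof.
move=> theta Hhat F K_geom K_indep K_indep_chain X_markov Hhat_adapted L V_diff gradV_lip
  G G_gt0 H_bounded c1 c2 c2_gt0 Hhat_bias Hhat_second_moment epsl varpiN
  b0 b1 b2 b3 b4 N N_ge1 r r_law r_indep.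
have G0 := ltW G_gt0; have /andP[r0 r1] := rho1P; have /andP[r20 r21] := rho2P.
have r1' : 0 < 1 - rho1 by rewrite subr_gt0.
pose s w := amsgrad H rho1 rho2 delta gamma T eps theta0 (fun j => K j w) (fun j i => Xs j i w).
pose g w n := Hhat n w.
have s0 w : s w 0%N = AmsgradState theta0 0 0 0 by [].
have sS w n : s w n.+1 = amsgrad_step rho1 rho2 delta gamma eps n (s w n) (g w n.+1) by [].
have HG := enorm_field_le H G H_bounded.
have gradV_bound x : enorm (grad V x) <= G.
  by rewrite -h_grad; apply: enorm_mean_field_le.
(* The Lipschitz bound at two distinct points, which exist since d > 0. *)
have L_ge0 : 0 <= L.
  have := gradV_lip (delta_mx (Ordinal d_gt0) 0) 0.
  rewrite subr0 => /(le_trans (enorm_ge0 _)); rewrite pmulr_lge0 //.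
  rewrite lt_def enorm_ge0 andbT; apply/eqP => e0.
  have := coord_le_enorm (delta_mx (Ordinal d_gt0) 0 : 'cV[R]_d) (Ordinal d_gt0).
  by rewrite e0 mxE !eqxx /= normr1 ler10.
have g_bounded n : exists C, forall w, enorm (g w n.+1) <= C.
  exists (G + 2 * G * T n.+1) => w; apply: enorm_mlmc_le_level => //.
  exact: ltW (T_gt0 _ _).
(* The second moment bound is nonnegative, hence so is the logarithm. *)
have lnT_ge0 n : 0 <= ln (T n.+1).
  have : (0 <= (c2 * G ^+ 2 * ln (T n.+1))%:E)%E.
    apply: le_trans (Hhat_second_moment n); apply: expectation_ge0 => w.
    exact: sqr_ge0.
  by rewrite lee_fin pmulr_rge0 // mulr_gt0 // exprn_gt0.
have T_ge1 n : 1 <= T n.+1.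
  rewrite leNgt; apply/negP => T1.
  by have := lnT_ge0 n; rewrite leNgt ln_lt0 // T_gt0.
pose S n := history K Xs [set j | (1 <= j <= n)%N].
have F_sub n : <<s S n >> `<=` @measurable _ Omega by exact: history_measurable.
have g_adapted n j i : (1 <= j <= n)%N -> measurable_wrt <<s S n >> (fun w => g w j i 0).
  move=> /andP[j1 jn] D mD.
  apply: (history_mono _ _ _ [set l | (1 <= l <= j)%N]); last exact: Hhat_adapted.
  by move=> l /= /andP[-> lj]; exact: leq_trans lj jn.
pose M n := c2 * G ^+ 2 * ln (T n).
have cG : 0 < c2 * G ^+ 2 by rewrite mulr_gt0 // exprn_gt0.
have M_ge0 n : 0 <= M n.+1 by rewrite mulr_ge0 // ltW.
have M_nondec n m : (1 <= n <= m)%N -> M n <= M m.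
  move=> nm; rewrite ler_pM2l //; have /andP[n1 nm'] := nm.
  by rewrite ler_ln ?posrE ?T_gt0 ?T_nondec // (leq_trans n1).
have bg n i : bounded_measurable (fun w => g w n.+1 i 0).
  split.
    by move=> _ D mD; rewrite setTI; apply: (F_sub n.+1); apply: g_adapted => //=; rewrite leqnn.
  by have [C gC] := g_bounded n; exists C => w; apply: le_trans (coord_le_enorm _ _) (gC w).
have bg2 n : bounded_measurable (fun w => enorm (g w n.+1) ^+ 2).
  under eq_fun do rewrite sqr_enorm.
  by apply: bm_sum => i _; apply: bmX; exact: bg.
have g_moment n : mean P (fun w => enorm (g w n.+1) ^+ 2) <= M n.+1.
  by rewrite -lee_fin -expectation_mean //; exact: Hhat_second_moment.
have g_bias n : exists Y : Omega -> 'cV[R]_d,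
    is_cond_exp_vec P <<s S n >> (fun w => g w n.+1) Y /\
    {ae P, forall w, enorm (Y w - grad V (iterate (s w n))) <= c1 * G / T n.+1}.
  have [Y [Y1 Y2]] := Hhat_bias n; exists Y; split => //.
  by apply: filterS Y2 => w; rewrite h_grad.
pose B := Num.sqrt d%:R * (G + 2 * G * (ln (T 1%N) / ln 2)).
have bcap := bm_capped_level P (K 1%N) (T 1%N) (ltW (T_gt0 1%N isT)).
have g1_mean : mean P (fun w => \sum_(i < d) `|g w 1%N i 0|) <= B.
  have bc := bmZ (2 * G) _ bcap.
  apply: (@le_trans _ _ (mean P (fun w =>
      Num.sqrt d%:R * (G + 2 * G * capped_level (T 1%N) (K 1%N w))))).
    apply: mean_le.
    - by apply: bm_sum => i _; apply: bm_norm; exact: bg.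
    - by apply: bmZ; apply: bmD => //; exact: bm_cst.
    - move=> w; apply: (le_trans (l1_le_enorm _)); rewrite ler_wpM2l ?sqrtr_ge0 //.
      exact: enorm_mlmc_le.
  rewrite meanZ; last by apply: bmD => //; exact: bm_cst.
  rewrite (meanD P _ _ (bm_cst _) bc) mean_cst meanZ // ler_wpM2l ?sqrtr_ge0 // lerD2l.
  rewrite ler_wpM2l ?mulr_ge0 //; apply: mean_capped_level => //.
  by move=> k k1; exact: K_geom.
have := weighted_gradient_sum P rho1 rho2 delta gamma eps rho1P rho2P delta_gt0 gamma_gt0
  gamma_noninc eps_gt0 eps_nondec theta0 s g s0 sS V L G (V theta_star) V_diff gradV_lip
  gradV_bound L_ge0 theta_starP S F_sub g_adapted g_bounded M (fun n => c1 * G / T n.+1)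
  M_ge0 M_nondec g_moment g_bias B g1_mean N.
set Sgrad := \sum_(1 <= n < N.+1) _ => main.
set kap := (Num.sqrt delta)^-1 in main.
have sd0 : 0 < Num.sqrt delta by rewrite sqrtr_gt0.
have kap2 : kap ^+ 2 = delta^-1 by rewrite exprVn sqr_sqrtr // ltW.
pose f n w := enorm (grad V (theta n w)) ^+ 2.
have fC n w : 0 <= f n w <= G ^+ 2.
  by rewrite sqr_ge0 ler_sqr ?nnegrE ?enorm_ge0 // gradV_bound.
have f_alg n : measurable_wrt (algorithm_sigma K Xs) (f n).
  move=> D mD; apply: (history_mono _ _ _ [set l | (1 <= l <= n)%N]).
    by move=> l /= /andP[].
  exact: (sqr_grad_adapted rho1 rho2 delta gamma eps rho2P delta_gt0 eps_gt0
    eps_nondec theta0 s g s0 sS V L gradV_lip L_ge0 S g_adapted n).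
have epsl_gt0 n : 0 < epsl n.+1.
  rewrite invr_gt0 sqrtr_gt0 ltr_pwDl // mulr_ge0 ?(ltW (eps_gt0 _ _)) //.
  by rewrite subr_ge0 exprn_ile1 // ltW.
(* The index 0 has weight 0. *)
have varpiE : varpiN N = \sum_(1 <= n < N.+1) gamma n.+1 * epsl n.
  by rewrite /varpiN /varpi big_nat_recl //= mulr0 add0r big_add1.
have varpi_gt0 : 0 < varpiN N.
  rewrite varpiE; case: N N_ge1 {r_law main Sgrad varpiE} => // N _.
  rewrite big_nat_recl // ltr_pwDl ?mulr_gt0 ?gamma_gt0 //.
  by apply: sumr_ge0 => n _; rewrite mulr_ge0 ?(ltW (gamma_gt0 _ _)) // ltW.
have prE n : (n <= N)%N -> fine (P (r @^-1` [set n])) = gamma n.+1 * epsl n / varpiN N.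
  by move=> nN; rewrite r_law.
have sum1 : \sum_(0 <= n < N.+1) fine (P (r @^-1` [set n])) = 1.
  have -> : \sum_(0 <= n < N.+1) fine (P (r @^-1` [set n])) =
      \sum_(0 <= n < N.+1) gamma n.+1 * epsl n / varpiN N.
    by rewrite big_nat [RHS]big_nat; apply: eq_bigr => n /andP[_ nN]; exact: prE.
  by rewrite -mulr_suml divff // gt_eqF.
have [bfr fr_le] := mean_random_index P r _ f (G ^+ 2) N (history_measurable _ _ _ _)
  r_indep f_alg fC sum1.
have grad_le : mean P (fun w => f (r w) w) <=
    (varpiN N)^-1 * \sum_(1 <= n < N.+1) gamma n.+1 * (epsl n * mean P (f n)).
  apply: (le_trans fr_le); rewrite big_nat_recl // prE // mulr0 !mul0r add0r.
  rewrite mulr_sumr big_add1 /= big_nat [leRHS]big_nat; apply: ler_sum => n /andP[_ nN].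
  by rewrite prE //= [(varpiN N)^-1 * _]mulrC mulrA mulrAC.
rewrite (expectation_mean P _ bfr).
have -> : ('E_P[fun w => V (theta 0%N w)] = (V theta0)%:E)%E.
  by rewrite (expectation_mean P _ (bm_cst (V theta0))) mean_cst.
rewrite -EFinD -EFinM lee_fin; apply: (le_trans grad_le).
rewrite ler_wpM2l ?invr_ge0 ?(ltW varpi_gt0) //.
pose p n := gamma n ^+ 2 * M n.
have p0 n : 0 <= p n.+1 by rewrite mulr_ge0 ?sqr_ge0.
have budget := squares_budget rho1 L p N rho1P L_ge0 p0.
set A2 := \sum_(1 <= n < N.+2) _ in budget.
set A3 := \sum_(1 <= n < N.+1) (1 - _) * p _ in budget.
set A4 := \sum_(1 <= n < N.+1) p _ in budget.
have A3_ge0 : 0 <= A3.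
  rewrite /A3 big_nat; apply: sumr_ge0 => -[//|n] _.
  by rewrite mulr_ge0 // subr_ge0 exprn_ile1 // ltW.
have A4_ge0 : 0 <= A4 by apply: sumr_ge0.
have E2 : \sum_(1 <= n < N.+2) kap ^+ 2 * (gamma n ^+ 2 * ((1 - rho1 ^+ n) * M n)) = kap ^+ 2 * A2.
  by rewrite /A2 mulr_sumr; apply: eq_bigr => n _; rewrite /p; ring.
have E3 : \sum_(1 <= n < N.+1) 2 * (kap ^+ 2 * (gamma n ^+ 2 * ((1 - rho1 ^+ n) * M n)))
    = 2 * kap ^+ 2 * A3.
  by rewrite /A3 mulr_sumr; apply: eq_bigr => n _; rewrite /p; ring.
set P1 := \sum_(1 <= n < N.+1) gamma n.+1 ^+ 2 * ln (T n.+1).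
have E4 : A4 = c2 * G ^+ 2 * P1.
  by rewrite /A4 mulr_sumr; apply: eq_bigr => n _; rewrite /p /M; ring.
set P3 := \sum_(1 <= n < N.+1) (1 - rho1 ^+ n) * gamma n ^+ 2 * ln (T n).
have E5 : A3 = c2 * G ^+ 2 * P3.
  by rewrite /A3 mulr_sumr; apply: eq_bigr => n _; rewrite /p /M; ring.
set Pb := \sum_(1 <= n < N.+1) gamma n.+1 / T n.+1.
have ES : \sum_(1 <= n < N.+1) gamma n.+1 * (epsl n * mean P (f n)) = Sgrad + b1 * Pb.
  rewrite /Sgrad /Pb mulr_sumr -big_split; apply: eq_bigr => n _ /=.
  rewrite mulrBr /b1 -/kap /f /epsl /theta -/(s _) /kap; ring.
rewrite ES.
rewrite E2 E3 -/A4 in main.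
set A5 := \sum_(1 <= n < N.+1) (1 - _) in main *.
have rho1n : 1 - rho1 != 0 by rewrite gt_eqF.
have deltan : delta != 0 by rewrite gt_eqF.
have ln2n : ln 2 != 0 :> R by rewrite gt_eqF // ln_gt0 // ltr1n.
have Eb0 : b0 = d%:R * (G * kap ^+ 2 / 2 / (1 - rho1)) + G * kap * gamma 1%N * B
    + kap ^+ 2 * (L * p 1%N).
  rewrite /b0 /epsl /= !mul0r addr0 kap2 /p /M /B.
  have -> : Num.sqrt (d%:R / delta) = Num.sqrt d%:R * kap.
    by rewrite sqrtrM ?ler0n // sqrtrV // ltW.
  by field; rewrite ?rho1n ?deltan ?ln2n.
have Eb2 : b2 * P1 = kap ^+ 2 * ((1 / 2 + L) * A4) + G * A4.
  by rewrite E4 /b2 kap2; field.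
have Eb3 : b3 * P3 = kap ^+ 2 * ((rho1 ^+ 2 * L ^+ 2 + 2 * rho1 ^+ 2 * L) / (2 * (1 - rho1)) * A3)
    + rho1 * G / 2 * A3.
  by rewrite E5 /b3 kap2; field; rewrite ?rho1n ?deltan ?ln2n.
have Eb4 : b4 * A5 = d%:R * (rho1 * G / (2 * (1 - rho1)) * kap ^+ 2) * A5.
  by rewrite /b4 kap2; field; rewrite ?rho1n ?deltan ?ln2n.
rewrite Eb0 Eb2 Eb3 Eb4.
have hb := ler_wpM2l (sqr_ge0 kap) budget.
have h1 : G * (1 + rho1) / 2 * A4 <= G * A4.
  by rewrite ler_wpM2r // -mulrA ler_piMr //; lra.
have h2 : 0 <= rho1 * G / 2 * A3 by rewrite mulr_ge0 // divr_ge0 // mulr_ge0.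
lra.
Qed.
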